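(* Let $(\Omega,\Sigma,\mu)$ be a probability space. Let $Y$ be a closed subspace of a real Banach space $X$ such that $X^*$ has the Radon-Nikodým property. Then: (a) for $1<p<\infty$, $Y$ has property-$U$ in $X$ if and only if $L_p(\mu,Y)$ has property-$U$ in $L_p(\mu,X)$; (b) for $1<p<\infty$, $Y$ has property-$SU$ in $X$ if and only if $L_p(\mu,Y)$ has property-$SU$ in $L_p(\mu,X)$.
   Context: All Banach spaces are real and subspaces are closed. For a closed subspace $Y$ of a Banach space $X$, $Y^\perp\subseteq X^*$ denotes the annihilator of $Y$. $Y$ has property-$U$ in $X$ if every $f\in Y^*$ has a unique norm-preserving extension $\tilde f\in X^*$. $Y$ has property-$SU$ in $X$ if $Y^\perp$ has a complementary subspace $G\subseteq X^*$ such that for every $f\in X^*$, writing $f=g+h$ with $g\in G$, $h\in Y^\perp$, one has $\|f\|>\|g\|$ whenever $h\neq 0$. $L_p(\mu,X)$ is the Banach space of (a.e. classes of) $p$-th Bochner integrable functions $f:\Omega\to X$ with norm $\|f\|_p=\left(\int_\Omega\|f(t)\|^p\,d\mu(t)\right)^{1/p}$, and $L_p(\mu,Y)$ is regarded as the closed subspace of $Y$-valued functions. A Banach space $X$ has the Radon-Nikodým property if for any probability space $(\Omega,\Sigma,\mu)$ and any $\mu$-continuous vector measure $G:\Sigma\to X$ of bounded variation there exists $g\in L_1(\mu,X)$ with $G(E)=\int_E g\,d\mu$ for all $E\in\Sigma$. *)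

(* Defs.v *)
From HB Require Import structures.
From mathcomp Require Import all_boot all_order all_algebra.
From mathcomp Require Import generic_quotient ring_quotient.
From mathcomp Require Import all_classical all_reals all_analysis.
From mathcomp Require Import measurable_realfun.

Set Implicit Arguments.
Unset Strict Implicit.
Unset Printing Implicit Defensive.
Import Order.TTheory GRing.Theory Num.Theory.
Import numFieldNormedType.Exports.

Local Open Scope classical_set_scope.
Local Open Scope ring_scope.

(* The dual [X^*] of a real normed space: continuous linear functionals with the
   operator norm. *)
Section Dual.
Context {R : realType} (X : normedModType R).

Definition dual_pred : {pred X -> R^o} :=
  [pred f | `[< linear f /\ continuous f >]].

Lemma dual_submod_closed : submod_closed dual_pred.
Proof.
split.
  apply/asboolP; split; first by move=> a x y; rewrite /= scaler0 addr0.
  exact: cst_continuous.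
move=> a f g /asboolP[lf cf] /asboolP[lg cg]; apply/asboolP; split.
  move=> b x y; rewrite /= !fctE lf lg !scalerDr !scalerA [b * a]mulrC.
  by rewrite -!addrA; congr +%R; rewrite addrCA.
move=> x; apply: continuousD; last exact: cg.
by apply: continuousM; [exact: cst_continuous|exact: cf].
Qed.

HB.instance Definition _ := GRing.isSubmodClosed.Build _ _ dual_pred
  dual_submod_closed.

Record dual : Type :=
  Dual { dual_fun :> X -> R^o ; dual_funP : dual_fun \in dual_pred }.

HB.instance Definition _ := [isSub for dual_fun].
HB.instance Definition _ := [Choice of dual by <:].
HB.instance Definition _ := [SubChoice_isSubLmodule of dual by <:].

Lemma dual_linear (f : dual) : linear f.
Proof. by have /asboolP[] := dual_funP f. Qed.

HB.instance Definition _ (f : dual) :=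
  GRing.isLinear.Build R X R^o _ (dual_fun f) (dual_linear f).

Lemma dual_continuous (f : dual) : continuous f.
Proof. by have /asboolP[] := dual_funP f. Qed.

Definition dual_norm (f : dual) : R :=
  sup [set `|f x| | x in [set x : X | `|x| <= 1]].

Lemma dual_norm_has_sup (f : dual) :
  has_sup [set `|f x| | x in [set x : X | `|x| <= 1]].
Proof.
split; first by exists `|f 0|, 0; rewrite //= normr0.
have /linear_boundedP/pinfty_ex_gt0[M M0 fM] :=
  continuous_linear_bounded 0 (@dual_continuous f 0).
exists M => _ [x /= x1 <-]; apply: le_trans (fM x) _.
by rewrite ler_piMr// ltW.
Qed.

Lemma le_dual_norm (f : dual) x : `|f x| <= dual_norm f * `|x|.
Proof.
have [->|x0] := eqVneq x 0; first by rewrite linear0 !normr0 mulr0.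
have nx : 0 < `|x| by rewrite normr_gt0.
rewrite -ler_pdivrMr//.
have -> : `|f x| / `|x| = `|f (`|x|^-1 *: x)|.
  by rewrite linearZ/= normrZ normfV normr_id mulrC.
apply: sup_upper_bound; first exact: dual_norm_has_sup.
by exists (`|x|^-1 *: x) => //=; rewrite normfZV.
Qed.

Lemma dual_norm_le (f : dual) M :
  (forall x, `|x| <= 1 -> `|f x| <= M) -> dual_norm f <= M.
Proof.
move=> fM; apply: ge_sup; first by case: (dual_norm_has_sup f).
by move=> _ [x /= x1 <-]; exact: fM.
Qed.

Lemma dual_norm_ge0 f : 0 <= dual_norm f.
Proof.
apply: sup_upper_bound; first exact: dual_norm_has_sup.
by exists 0; rewrite /= ?linear0 !normr0.
Qed.

Lemma le_dual_norm1 (f : dual) x : `|x| <= 1 -> `|f x| <= dual_norm f.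
Proof.
move=> x1; apply: le_trans (le_dual_norm f x) _.
by rewrite ler_piMr// dual_norm_ge0.
Qed.

Lemma ler_dual_normD (f g : dual) :
  dual_norm (f + g) <= dual_norm f + dual_norm g.
Proof.
apply: dual_norm_le => x x1.
apply: le_trans (ler_normD _ _) _.
by apply: lerD; exact: le_dual_norm1.
Qed.

Let dual_normZ_le (a : R) (f : dual) :
  dual_norm (a *: f) <= `|a| * dual_norm f.
Proof.
apply: dual_norm_le => x x1.
rewrite [_ x]/(a * f x) normrM.
by rewrite ler_wpM2l// le_dual_norm1.
Qed.

Lemma dual_normZ (a : R) (f : dual) : dual_norm (a *: f) = `|a| * dual_norm f.
Proof.
apply/eqP; rewrite eq_le dual_normZ_le/=.
have [->|a0] := eqVneq a 0; first by rewrite normr0 mul0r dual_norm_ge0.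
rewrite -ler_pdivlMl ?normr_gt0// -normfV.
by apply: le_trans (dual_normZ_le _ _); rewrite scalerA mulVf// scale1r.
Qed.

Lemma dual_norm0_eq0 (f : dual) : dual_norm f = 0 -> f = 0.
Proof.
move=> f0; apply/val_inj/funext => x; apply/eqP.
by rewrite -normr_le0 (le_trans (le_dual_norm f x))// f0 mul0r.
Qed.

HB.instance Definition _ := @Lmodule_isNormed.Build R dual dual_norm
  ler_dual_normD dual_normZ dual_norm0_eq0.

Lemma dual_normE (f : dual) : `|f| = dual_norm f.
Proof. by []. Qed.

Lemma dual_cauchy_cvg (F : set_system dual) :
  ProperFilter F -> cauchy F -> cvg F.
Proof.
move=> FF /cauchyP cF.
have cvx x : cvg ((fun f : dual => f x : R) @ F).
  apply: cauchy_cvg; apply: cauchy_exP => e e0.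
  have x10 : 0 < `|x| + 1 by rewrite ltr_wpDl.
  have [f0 Ff0] := cF _ (divr_gt0 e0 x10).
  exists (f0 x).
  suff : F [set f : dual | ball (f0 x : R) e (f x : R)] by [].
  apply: filterS Ff0 => f /=.
  rewrite -!ball_normE/= => ff0.
  apply: le_lt_trans (le_dual_norm (f0 - f) x) _.
  apply: (@le_lt_trans _ _ (dual_norm (f0 - f) * (`|x| + 1))).
    by rewrite ler_wpM2l ?dual_norm_ge0// lerDl.
  by rewrite -ltr_pdivlMr.
pose g x : R^o := lim ((fun f : dual => f x : R) @ F).
have lg : linear g.
  move=> a x y; apply: cvg_lim => //.
  have -> : (fun f : dual => f (a *: x + y) : R) =
            (fun f : dual => a * f x + f y).
    by apply/funext => f; rewrite linearP.
  by apply: cvgD; [apply: cvgMr; exact: cvx|exact: cvx].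
have gb (f0 : dual) e : F (ball f0 e) -> forall x, `|f0 x - g x| <= e * `|x|.
  move=> Ff0 x.
  have cvn : `|f0 x - f x| @[f --> F] --> `|f0 x - g x|.
    by apply: cvg_norm; apply: cvgB; [exact: cvg_cst|exact: cvx].
  rewrite -(cvg_lim _ cvn)//; apply: limr_le; first by apply/cvg_ex; eexists; exact: cvn.
  suff : F [set f : dual | `|f0 x - f x| <= e * `|x|] by [].
  apply: filterS Ff0 => f /=; rewrite -ball_normE/= => /ltW ff0.
  apply: le_trans (le_dual_norm (f0 - f) x) _.
  by rewrite ler_wpM2r.
pose gl : {linear X -> R^o} := HB.pack g (GRing.isLinear.Build _ _ _ _ g lg).
have cg : continuous g.
  apply: (@bounded_linear_continuous _ _ _ gl); apply/linear_boundedP.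
  have [f0 Ff0] := cF 1 ltr01.
  near=> r => x /=.
  rewrite -[g x](subrK (f0 x)) -normrN opprD opprB.
  apply: le_trans (ler_normB _ _) _.
  apply: (@le_trans _ _ ((1 + dual_norm f0) * `|x|)).
    by rewrite mulrDl lerD ?le_dual_norm// gb.
  rewrite ler_wpM2r//; near: r; exact: nbhs_pinfty_ge.
have gP : g \in dual_pred by apply/asboolP.
apply/cvg_ex; exists (Dual gP); apply/cvgrPdist_lt => e e0.
have e20 : 0 < e / 2 by rewrite divr_gt0.
have [f0 Ff0] := cF _ e20.
suff : F [set f : dual | `|Dual gP - f| < e] by [].
apply: filterS (Ff0) => f /=; rewrite -ball_normE/= => ff0.
rewrite -(subrKA f0) (le_lt_trans (ler_normD _ _))// [e]splitr ler_ltD//.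
apply: dual_norm_le => x x1.
rewrite [X in `|X|](_ : _ = g x - f0 x)// distrC.
by apply: le_trans (gb _ _ Ff0 x) _; rewrite ler_piMr// ltW.
Unshelve. all: by end_near. Qed.

HB.instance Definition _ := Uniform_isComplete.Build dual dual_cauchy_cvg.

End Dual.

Section NormedSubspace.
Context {R : realType} {V : normedModType R} (Y : submodClosed V).

Record normed_subspace : Type :=
  NormedSubspace { subspace_val :> V ; subspace_valP : subspace_val \in Y }.

HB.instance Definition _ := [isSub for subspace_val].
HB.instance Definition _ := [Choice of normed_subspace by <:].
HB.instance Definition _ := [SubChoice_isSubLmodule of normed_subspace by <:].

Definition subspace_norm (y : normed_subspace) : R := `|subspace_val y|.

Lemma ler_subspace_normD (x y : normed_subspace) :
  subspace_norm (x + y) <= subspace_norm x + subspace_norm y.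
Proof. exact: ler_normD. Qed.

Lemma subspace_normZ (a : R) (x : normed_subspace) :
  subspace_norm (a *: x) = `|a| * subspace_norm x.
Proof. exact: normrZ. Qed.

Lemma subspace_norm0_eq0 (x : normed_subspace) : subspace_norm x = 0 -> x = 0.
Proof. by move=> /normr0_eq0 x0; exact/val_inj. Qed.

HB.instance Definition _ := @Lmodule_isNormed.Build R normed_subspace
  subspace_norm ler_subspace_normD subspace_normZ subspace_norm0_eq0.

Definition annihilator : set (dual V) := [set f | forall y, y \in Y -> f y = 0].

(* A functional on [Y] is an element of the dual of [Y] seen as a normed space
   in its own right, and [F y] evaluates [F] at the image of [y] in [V]. *)
Definition property_U : Prop :=
  forall f : dual normed_subspace,
    exists! F : dual V, (forall y : normed_subspace, F y = f y) /\ `|F| = `|f|.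

Definition complement_of_annihilator (G : submodClosed (dual V)) : Prop :=
  [/\ closed [set` G],
      [set` G] `&` annihilator = [set 0] &
      forall f, exists g h, [/\ g \in G, annihilator h & f = g + h]].

Definition property_SU : Prop :=
  exists2 G : submodClosed (dual V), complement_of_annihilator G &
    forall f g h, g \in G -> annihilator h -> f = g + h -> h != 0 ->
      `|g| < `|f|.

End NormedSubspace.

Section SimpleFunctions.
Context d {T : measurableType d} {R : realType} {X : normedModType R}.

Definition simple_function (s : T -> X) : Prop :=
  finite_set (range s) /\ forall x, measurable (s @^-1` [set x]).

(* Strong measurability is required everywhere rather than almost everywhere,
   so that [fun t => `|f t|] is measurable; every almost everywhere limit of
   simple functions is almost everywhere equal to such a function, hence the
   classes in [Lp] below are the same. *)
Definition strongly_measurable (f : T -> X) : Prop :=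
  exists2 s : nat -> T -> X, (forall n, simple_function (s n)) &
    forall t, s n t @[n --> \oo] --> f t.

Lemma simple_preimage s (A : set X) : simple_function s ->
  measurable (s @^-1` A).
Proof.
move=> [fs ms].
have -> : s @^-1` A = \bigcup_(y in range s `&` A) s @^-1` [set y].
  apply/seteqP; split=> [t /= At|t [y [_ Ay] /= ->]//].
  by exists (s t) => //; split => //; exists t.
by apply: fin_bigcup_measurable => //; exact: finite_setIl.
Qed.

Lemma simple_comp2 (h : X -> X -> X) s t :
  simple_function s -> simple_function t ->
  simple_function (fun x => h (s x) (t x)).
Proof.
move=> ss st; split.
  apply: (@sub_finite_set _ _ [set h x y | x in range s & y in range t]).
    by move=> _ [x _ <-]; exists (s x); [exists x|exists (t x) => //; exists x].
  by apply: finite_image2; [case: ss|case: st].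
move=> x.
rewrite [X in measurable X](_ : _ = \bigcup_(y in range s)
  (s @^-1` [set y] `&` t @^-1` [set z | h y z = x])).
  apply: fin_bigcup_measurable; first by case: ss.
  by move=> y _; apply: measurableI; exact: simple_preimage.
apply/seteqP; split=> [u /= hx|u [y _ /= [-> //]]].
by exists (s u) => //; exists u.
Qed.

Lemma simple_cst x : simple_function (cst x).
Proof.
split; first by apply: (sub_finite_set _ (finite_set1 x)) => _ [t _ <-].
by move=> y; rewrite preimage_cst; case: ifP.
Qed.

Lemma strongly_measurable0 : strongly_measurable (0 : T -> X).
Proof.
by exists (fun=> cst 0) => [_|t]; [exact: simple_cst|exact: cvg_cst].
Qed.

Lemma strongly_measurable_lin a f g :
  strongly_measurable f -> strongly_measurable g ->
  strongly_measurable (a *: f + g).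
Proof.
move=> [s ss sf] [t st tg].
exists (fun n u => a *: s n u + t n u) => [n|u].
  exact: (simple_comp2 (fun x y => a *: x + y)).
by apply: cvgD => //; apply: cvgZr; exact: sf.
Qed.

Lemma strongly_measurable_norm f : strongly_measurable f ->
  measurable_fun setT (fun t => `|f t|).
Proof.
move=> [s ss sf].
apply: (@measurable_fun_cvg _ _ _ _ (fun n t => `|s n t|)).
  move=> n _ B mB; rewrite setTI.
  exact: (@simple_preimage _ [set x | B `|x|]).
by move=> t _; apply: cvg_norm; exact: sf.
Qed.

End SimpleFunctions.

Section Bochner.
Context d (T : measurableType d) (R : realType).
Variable mu : probability T R.
Variable X : normedModType R.

Definition simple_integral (E : set T) (s : T -> X) : X :=
  \sum_(x \in range s) fine (mu (s @^-1` [set x] `&` E)) *: x.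

Definition has_bochner_integral (E : set T) (g : T -> X) (z : X) : Prop :=
  exists s : nat -> T -> X,
    [/\ forall n, simple_function (s n),
        (\int[mu]_t `|g t - s n t|%:E)%E @[n --> \oo] --> 0%E &
        simple_integral E (s n) @[n --> \oo] --> z].

Variable p : R.
Hypothesis p1 : 1 <= p.

(* The proof argument is unused in the body: it makes the exponent condition
   available to the inference of the structures on [Lpfun] and [Lp]. *)
Definition Lpfun_pred (_ : 1 <= p) : {pred T -> X} :=
  [pred f | `[< strongly_measurable f /\
    ('N[mu]_p%:E[(fun t => `|f t|%:E)] < +oo)%E >]].

Local Notation N f := ('N[mu]_p%:E[(fun t => `|f t|%:E)])%E.

Lemma measurable_abse_poweR (h : T -> \bar R) : measurable_fun setT h ->
  measurable_fun setT (fun t => `|h t| `^ p)%E.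
Proof.
move=> mh; apply: (@measurableT_comp _ _ _ _ _ _ (@poweR R ^~ p)).
  exact: measurable_poweR.
exact: measurableT_comp.
Qed.

Lemma ge0_le_Lnorm (f g : T -> R) : measurable_fun setT f -> measurable_fun setT g ->
  (forall t, 0 <= f t <= g t) ->
  ('N[mu]_p%:E[EFin \o f] <= 'N[mu]_p%:E[EFin \o g])%E.
Proof.
move=> mf mg fg; have p0 : 0 <= p by exact: le_trans p1.
rewrite unlock; apply: gt0_ler_poweR.
- by rewrite invr_ge0.
- by rewrite in_itv/= leey andbT integral_ge0// => *; exact: poweR_ge0.
- by rewrite in_itv/= leey andbT integral_ge0// => *; exact: poweR_ge0.
apply: ge0_le_integral => //.
- by move=> *; exact: poweR_ge0.
- exact/measurable_abse_poweR/measurable_EFinP.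
- exact/measurable_abse_poweR/measurable_EFinP.
move=> t _; have /andP[f0 fgt] := fg t.
apply: gt0_ler_poweR => //; rewrite ?in_itv/= ?leey ?lee_fin ?normr_ge0//.
by rewrite !ger0_norm// (le_trans f0).
Qed.

Lemma Lnorm_normrD (f g : T -> X) : strongly_measurable f -> strongly_measurable g ->
  (N (f + g)%R <= N f + N g)%E.
Proof.
move=> sf sg; have sfg := strongly_measurable_lin 1 sf sg.
rewrite scale1r in sfg.
have mf := strongly_measurable_norm sf.
have mg := strongly_measurable_norm sg.
have mfg := strongly_measurable_norm sfg.
apply: le_trans (minkowski_EFin mu mf mg p1).
apply: ge0_le_Lnorm => //; first exact: measurable_funD.
by move=> t; rewrite normr_ge0/= ler_normD.
Qed.

Lemma Lnorm_normrZ a (f : T -> X) : strongly_measurable f -> (N f < +oo)%E ->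
  (N (a *: f)%R = `|a|%:E * N f)%E.
Proof.
move=> sf Nf; have mf := strongly_measurable_norm sf.
have p0 : 0 <= p by exact: le_trans p1.
have -> : (fun t => `|(a *: f) t|%:E) = (fun t => (`|a|%:E * `|f t|%:E)%E).
  by apply/funext => t; rewrite /= fctE normrZ EFinM.
rewrite unlock.
under eq_integral do rewrite abseM poweRM ?abse_ge0//.
have me : measurable_fun setT (fun t => `|f t|%:E) by exact/measurable_EFinP.
rewrite ge0_integralZl//; last 3 first.
- exact: measurable_abse_poweR me.
- by move=> *; exact: poweR_ge0.
- exact: poweR_ge0.
rewrite poweRM ?poweR_ge0//; last by rewrite integral_ge0// => *; exact: poweR_ge0.
rewrite -poweRrM mulfV ?gt_eqF ?(lt_le_trans ltr01)// poweRe1 ?abse_ge0//.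
by rewrite abse_EFin normr_id.
Qed.

Lemma Lpfun_submod_closed : submod_closed (Lpfun_pred p1).
Proof.
have p0 : p%:E != 0%E by rewrite gt_eqF// lte_fin (lt_le_trans ltr01).
split.
  apply/asboolP; split; first exact: strongly_measurable0.
  rewrite (_ : (fun _ => _) = cst 0%E); first by rewrite Lnorm0.
  by apply/funext => t; rewrite [X in `|X|](_ : _ = 0)// normr0.
move=> a f g /asboolP[sf Nf] /asboolP[sg Ng]; apply/asboolP.
have saf : strongly_measurable (a *: f).
  by rewrite -[_ *: f]addr0; apply: strongly_measurable_lin => //;
    exact: strongly_measurable0.
split; first exact: strongly_measurable_lin.
apply: le_lt_trans (Lnorm_normrD saf sg) _; rewrite Lnorm_normrZ//.
by rewrite lte_add_pinfty// lte_mul_pinfty// lee_fin.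
Qed.

HB.instance Definition _ := GRing.isSubmodClosed.Build _ _ (Lpfun_pred p1)
  Lpfun_submod_closed.

Record Lpfun : Type :=
  LpFun { Lpfun_fun :> T -> X ; Lpfun_funP : Lpfun_fun \in Lpfun_pred p1 }.

HB.instance Definition _ := [isSub for Lpfun_fun].
HB.instance Definition _ := [Choice of Lpfun by <:].
HB.instance Definition _ := [SubChoice_isSubLmodule of Lpfun by <:].

Definition Lpnull : {pred Lpfun} :=
  [pred f : Lpfun | `[< {ae mu, forall t, f t = 0} >]].

Lemma Lpnull_submod_closed : submod_closed Lpnull.
Proof.
split; first by apply/asboolP; exact: aeW.
move=> a f g /asboolP f0 /asboolP g0; apply/asboolP.
by apply: filterS2 f0 g0 => t ft gt; rewrite /= !fctE ft gt scaler0 addr0.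
Qed.

HB.instance Definition _ := GRing.isSubmodClosed.Build _ _ Lpnull
  Lpnull_submod_closed.

End Bochner.

Section Lp.
Context d (T : measurableType d) (R : realType).
Variable mu : probability T R.
Variable X : normedModType R.
Variables (p : R) (p1 : 1 <= p).

Local Notation N f := ('N[mu]_p%:E[(fun t => `|f t|%:E)])%E.
Local Notation Lpnull := (@Lpnull _ T R mu X p p1).

Lemma ae_eq_Lnorm_normr (f g : T -> X) :
  strongly_measurable f -> strongly_measurable g ->
  {ae mu, forall t, f t = g t} -> N f = N g.
Proof.
move=> sf sg fg.
rewrite unlock; congr (_ `^ _)%E; apply: ge0_ae_eq_integral => //.
- by apply: measurable_abse_poweR;
    exact/measurable_EFinP/strongly_measurable_norm.
- by apply: measurable_abse_poweR;
    exact/measurable_EFinP/strongly_measurable_norm.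
- by move=> t _; exact: poweR_ge0.
- by move=> t _; exact: poweR_ge0.
by apply: filterS fg => t fgt _; rewrite fgt.
Qed.

Local Notation Lpfun := (Lpfun mu X p1).
Local Open Scope quotient_scope.
Definition Lp : Type := Quotient.quot (Lpnull : zmodClosed Lpfun).

HB.instance Definition _ := GRing.Zmodule.on Lp.
HB.instance Definition _ := Quotient.on Lp.

(* A chosen representative: only its almost everywhere class is meaningful. *)
Definition Lp_fun (u : Lp) : T -> X := Lpfun_fun (repr u : Lpfun).
Coercion Lp_fun : Lp >-> Funclass.

Lemma Lp_piP (f g : Lpfun) :
  \pi_Lp f = \pi_Lp g <-> {ae mu, forall t, f t = g t}.
Proof.
split=> [/eqP|fg].
  rewrite -Quotient.idealrBE => /asboolP; apply: filterS => t /=.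
  exact: subr0_eq.
apply/eqP; rewrite -Quotient.idealrBE; apply/asboolP.
by apply: filterS fg => t fgt; have : f t - g t = 0 by rewrite fgt subrr.
Qed.

Lemma Lp_repr (f : Lpfun) : {ae mu, forall t, (\pi_Lp f : Lp) t = f t}.
Proof. by apply/Lp_piP; rewrite reprK. Qed.

Lemma Lp_eqP (u v : Lp) : u = v <-> {ae mu, forall t, u t = v t}.
Proof.
have := Lp_piP (repr u) (repr v); rewrite !reprK; exact.
Qed.

Definition Lp_scale (a : R) (u : Lp) : Lp := \pi_Lp (a *: (repr u : Lpfun)).

Lemma Lp_piZ a (f : Lpfun) : \pi_Lp (a *: f) = Lp_scale a (\pi_Lp f).
Proof.
apply/Lp_piP; apply: filterS (Lp_repr f) => t ft.
have : a *: f t = a *: (\pi_Lp f : Lp) t by rewrite ft.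
by [].
Qed.

Lemma Lp_piD (f g : Lpfun) : \pi_Lp (f + g) = \pi_Lp f + \pi_Lp g.
Proof. exact: raddfD. Qed.

Lemma Lp_scalerA a b u : Lp_scale a (Lp_scale b u) = Lp_scale (a * b) u.
Proof. by rewrite -[u]reprK -!Lp_piZ scalerA reprK. Qed.

Lemma Lp_scale1r : left_id 1 Lp_scale.
Proof. by move=> u; rewrite -[u in LHS]reprK -!Lp_piZ scale1r reprK. Qed.

Lemma Lp_scalerDr : right_distributive Lp_scale +%R.
Proof.
move=> a u v; rewrite -[u]reprK -[v]reprK.
by rewrite -Lp_piD -!Lp_piZ scalerDr Lp_piD.
Qed.

Lemma Lp_scalerDl u : {morph Lp_scale^~ u : a b / a + b}.
Proof. by move=> a b; rewrite -[u]reprK -!Lp_piZ scalerDl Lp_piD. Qed.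

HB.instance Definition _ := GRing.Zmodule_isLmodule.Build R Lp
  Lp_scalerA Lp_scale1r Lp_scalerDr Lp_scalerDl.

Definition Lp_norm (u : Lp) : R := fine ('N[mu]_p%:E[(fun t => `|u t|%:E)])%E.

Lemma LpfunP (f : Lpfun) : strongly_measurable f /\ (N f < +oo)%E.
Proof. by have /asboolP := Lpfun_funP f. Qed.

Lemma Lp_fun_sm (u : Lp) : strongly_measurable u.
Proof. by case: (LpfunP (repr u)). Qed.

Lemma Lp_normE (u : Lp) : (Lp_norm u)%:E = N u.
Proof.
rewrite /Lp_norm fineK// ge0_fin_numE ?Lnorm_ge0//.
by case: (LpfunP (repr u)).
Qed.

Lemma Lp_funD (u v : Lp) : {ae mu, forall t, (u + v : Lp) t = u t + v t}.
Proof. by rewrite -[u in u + _]reprK -[v in _ + v]reprK -Lp_piD; exact: Lp_repr. Qed.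

Lemma Lp_funZ a (u : Lp) : {ae mu, forall t, (a *: u : Lp) t = a *: u t}.
Proof. exact: Lp_repr. Qed.

Lemma Lp_fun0 : {ae mu, forall t, (0 : Lp) t = 0}.
Proof.
have -> : 0 = \pi_Lp (0 : Lpfun) by rewrite raddf0.
exact: Lp_repr.
Qed.

Lemma ler_Lp_normD (u v : Lp) : Lp_norm (u + v) <= Lp_norm u + Lp_norm v.
Proof.
have su := Lp_fun_sm u; have sv := Lp_fun_sm v.
rewrite -lee_fin EFinD !Lp_normE; apply: le_trans (Lnorm_normrD mu p1 su sv).
rewrite (@ae_eq_Lnorm_normr _ ((u : T -> X) + v))//.
- exact: Lp_fun_sm.
- by rewrite -[X in X + _]scale1r; exact: strongly_measurable_lin.
- exact: Lp_funD.
Qed.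

Lemma Lp_normZ (a : R) (u : Lp) : Lp_norm (a *: u) = `|a| * Lp_norm u.
Proof.
have su := Lp_fun_sm u.
apply: EFin_inj; rewrite EFinM !Lp_normE -(Lnorm_normrZ p1)//; last first.
  by case: (LpfunP (repr u)).
apply: ae_eq_Lnorm_normr; [exact: Lp_fun_sm| |exact: Lp_funZ].
rewrite -[_ *: _]addr0; apply: strongly_measurable_lin => //.
exact: strongly_measurable0.
Qed.

Lemma Lp_norm0_eq0 (u : Lp) : Lp_norm u = 0 -> u = 0.
Proof.
move=> u0; have /= := Lp_normE u; rewrite u0 => /esym/Lnorm_eq0_eq0 h.
have {h}u00 : {ae mu, forall t, u t = 0}.
  have /h : measurable_fun setT (fun t => `|u t|%:E).
    exact/measurable_EFinP/strongly_measurable_norm/Lp_fun_sm.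
  have p0 : (0 < p%:E)%E by rewrite lte_fin (lt_le_trans ltr01).
  by move=> /(_ p0); apply: filterS => t /(_ I)[/normr0_eq0].
apply/Lp_eqP; apply: filterS2 u00 Lp_fun0 => t -> ->; exact: erefl.
Qed.

HB.instance Definition _ := @Lmodule_isNormed.Build R Lp Lp_norm
  ler_Lp_normD Lp_normZ Lp_norm0_eq0.

Variable Y : submodClosed X.

(* [L_p(mu, Y)] inside [L_p(mu, X)]: the classes of the functions that take
   their values in [Y] almost everywhere *)
Definition Lp_subspace_pred : {pred Lp} :=
  [pred u : Lp | `[< {ae mu, forall t, u t \in Y} >]].

Lemma Lp_subspace_submod_closed : submod_closed Lp_subspace_pred.
Proof.
split.
  apply/asboolP; apply: filterS Lp_fun0 => t ->; exact: rpred0.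
move=> a /= u v /asboolP uY /asboolP vY; apply/asboolP.
have uv : {ae mu, forall t, (a *: u + v : Lp) t = a *: (u : Lp) t + (v : Lp) t}.
  by apply: filterS2 (Lp_funD (a *: u) v) (Lp_funZ a u) => t -> ->.
apply: filterS3 uv uY vY => t -> ut vt.
by rewrite rpredD// rpredZ.
Qed.

HB.instance Definition _ := GRing.isSubmodClosed.Build _ _ Lp_subspace_pred
  Lp_subspace_submod_closed.

Definition Lp_subspace : submodClosed Lp := Lp_subspace_pred.

End Lp.

Definition variation_bounded d (T : measurableType d) (R : realType)
    (Z : normedModType R) (G : set T -> Z) : Prop :=
  exists M : R, forall (n : nat) (E : 'I_n -> set T),
    (forall i, measurable (E i)) -> trivIset setT E ->
    \bigcup_i E i = setT -> \sum_(i < n) `|G (E i)| <= M.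

(* The values of [G] on non-measurable sets are irrelevant. *)
Definition vector_measure d (T : measurableType d) (R : realType)
    (Z : normedModType R) (G : set T -> Z) : Prop :=
  forall E : nat -> set T, (forall i, measurable (E i)) -> trivIset setT E ->
    \sum_(i < n) G (E i) @[n --> \oo] --> G (\bigcup_i E i).

Definition vector_measure_continuous d (T : measurableType d) (R : realType)
    (mu : probability T R) (Z : normedModType R) (G : set T -> Z) : Prop :=
  forall e : R, 0 < e -> exists2 delta : R, 0 < delta &
    forall E, measurable E -> (mu E < delta%:E)%E -> `|G E| < e.

Definition radon_nikodym_property (R : realType)
    (Z : completeNormedModType R) : Prop :=
  forall d (T : measurableType d) (mu : probability T R) (G : set T -> Z),
    vector_measure G -> vector_measure_continuous mu G ->
    variation_bounded G ->
    exists g : Lp mu Z (@lexx _ _ (1 : R)),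
      forall E, measurable E -> has_bochner_integral mu E g (G E).

(* Main.v *)
(* Call a functional [F] norm preserving for [Y] when its restriction to [Y] has
   the same norm. By Hahn-Banach, [Y] has property U iff norm preserving
   functionals that agree on [Y] are equal, and property SU iff moreover they are
   closed under addition. By the Radon-Nikodym property of [X^*], every functional
   on [L_p(mu, X)] is [u |-> \int g(t)(u(t))] for some [g] in [L_q(mu, X^* )]; its
   norm is the [L_q] norm of [|g|], and the norm of its restriction to
   [L_p(mu, Y)] is the [L_q] norm of [t |-> |g(t) restricted to Y|]. Hence it is
   norm preserving iff almost every [g(t)] is, and both properties of [Y] pass to
   [L_p(mu, Y)] pointwise; they come back through the constant functions [g].
   Restricting elements of [L_q(mu, X^* )] avoids the dual of [L_p(mu, Y)], that is
   the Radon-Nikodym property of [Y^*]. *)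
Require Import Defs.
From HB Require Import structures.
From mathcomp Require Import all_boot all_order all_algebra.
From mathcomp Require Import all_classical all_reals all_analysis.
From mathcomp Require Import measurable_realfun finmap ring lra.

Set Implicit Arguments.
Unset Strict Implicit.
Unset Printing Implicit Defensive.
Import Order.TTheory GRing.Theory Num.Theory.
Import numFieldNormedType.Exports.

Local Open Scope classical_set_scope.
Local Open Scope ring_scope.

(** * Norm preserving functionals *)

(** The obstacle is the lower bound for the norm of a functional with density [h]: it asks for
    vectors [u t] that almost norm [h t] and depend measurably on [t]. No measurable selection is
    made. Instead [h] is approximated in [L_1] by a simple function and one vector is chosen for
    each of its finitely many values; the error is small because the norm of a functional, on [X] or
    on [Y], is 1-Lipschitz. This is done once, for a set [D] of admissible vectors and a gauge [nu],
    and used twice. With [D = Y] it bounds the norm of the restriction from below. With [D = X] it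
    completes the representation theorem: the Radon-Nikodym property gives a density in [L_1] only,
    for which the formula is at first known on simple functions only, and the lower bound then puts
    this density in [L_q]. Property SU turns into additivity because the complement of the
    annihilator is forced: it has to be the set of norm preserving functionals, which is always
    closed and stable under scaling. *)

Section HahnBanach.
Context {R : realType} {V : normedModType R} (c : R).
Hypothesis c0 : 0 <= c.

(* Because of the bound, such a set is the graph of a partial linear form. *)
Definition bounded_linear_graph (G : set (V * R)) : Prop :=
  (forall a x r y s, G (x, r) -> G (y, s) -> G (a *: x + y, a * r + s)) /\
  (forall x r, G (x, r) -> `|r| <= c * `|x|).

Lemma bounded_linear_graph_fun G x r s : bounded_linear_graph G ->
  G (x, r) -> G (x, s) -> r = s.
Proof.
move=> [lG bG] Gr Gs; have := bG _ _ (lG (-1) _ _ _ _ Gr Gs).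
rewrite scaleN1r addNr normr0 mulr0 normr_le0 mulN1r addrC subr_eq0.
by move/eqP.
Qed.

(** One-dimensional extension. A value [b] at [v] has to satisfy [- (c * |x + v|) - r <= b <= c * |y
    + v| - s] for all [(x, r)] and [(y, s)] in [G]; the supremum of the left-hand sides will do. *)
Lemma bounded_linear_graph_extend G v : bounded_linear_graph G -> G (0, 0) ->
  exists2 G', bounded_linear_graph G' & G `<=` G' /\ exists b, G' (v, b).
Proof.
move=> [lG bG] G0.
pose S := [set - (c * `|z.1 + v|) - z.2 | z in G].
(* Lower and upper bounds are compatible: [s - r] is at most [c] times the norm of [y - x], which is
   [(y + v) - (x + v)]. *)
have key x r y s : G (x, r) -> G (y, s) ->
    - (c * `|x + v|) - r <= c * `|y + v| - s.
  move=> Gx Gy; have := bG _ _ (lG (-1) _ _ _ _ Gx Gy).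
  rewrite scaleN1r mulN1r => /ler_normlP[_].
  have : `|- x + y| <= `|y + v| + `|x + v|.
    rewrite (_ : - x + y = (y + v) - (x + v)) ?ler_normB//.
    by rewrite opprD addrACA subrr addr0 addrC.
  move=> /(ler_wpM2l c0); lra.
have S0 : S !=set0 by exists (- (c * `|0 + v|) - 0), (0, 0).
have bS : has_ubound S.
  by exists (c * `|0 + v| - 0) => _ [[x r] Gx <-]; exact: key.
have lob x r : G (x, r) -> - (c * `|x + v|) - r <= sup S.
  by move=> Gx; apply: ub_le_sup => //; exists (x, r).
have upb y s : G (y, s) -> sup S <= c * `|y + v| - s.
  by move=> Gy; apply: ge_sup => // _ [[x r] Gx <-]; exact: key.
set b := sup S in lob upb.
exists [set z | exists x r t, G (x, r) /\ z = (x + t *: v, r + t * b)].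
  split=> [a _ _ _ _ [x [r [t [Gx [-> ->]]]]] [y [s [u [Gy [-> ->]]]]]|].
    exists (a *: x + y), (a * r + s), (a * t + u); split; first exact: lG.
    congr pair; last by ring.
    by rewrite scalerDr scalerA scalerDl addrACA.
  move=> _ _ [x [r [t [Gx [-> ->]]]]].
  have [->|t0] := eqVneq t 0; first by rewrite scale0r mul0r !addr0; exact: bG.
  (* Divide by [t]: the bounds on [b] concern the coefficient 1 of [v]. *)
  have Gt : G (t^-1 *: x, t^-1 * r).
    by have := lG t^-1 _ _ _ _ Gx G0; rewrite !addr0.
  have -> : r + t * b = t * (t^-1 * r + b) by rewrite mulrDr mulVKf.
  have -> : x + t *: v = t *: (t^-1 *: x + v).
    by rewrite scalerDr scalerA mulfV// scale1r.
  rewrite normrM normrZ mulrCA ler_wpM2l// ler_norml.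
  by have := lob _ _ Gt; have := upb _ _ Gt; lra.
split=> [[x r] Gx|]; first by exists x, r, 0; rewrite scale0r mul0r !addr0.
by exists b, 0, 0, 1; rewrite scale1r mul1r !add0r.
Qed.

Lemma hahn_banach_graph G : bounded_linear_graph G -> G (0, 0) ->
  exists f : V -> R^o, [/\ linear f, (forall x, `|f x| <= c * `|x|) &
    forall x r, G (x, r) -> f x = r].
Proof.
move=> lG G0.
(* Zorn's lemma is applied to the sets [A] to be added to [G], so that the union of the empty chain
   is acceptable too. *)
have [A [PA maxA]] : exists A, bounded_linear_graph (G `|` A) /\
    forall B, A `<` B -> ~ bounded_linear_graph (G `|` B).
  apply: (@Zorn_bigcup _ [set A | bounded_linear_graph (G `|` A)]).
  move=> F FP totF; have mem z w : (G `|` \bigcup_(A in F) A) z ->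
      (G `|` \bigcup_(A in F) A) w -> exists B,
      [/\ bounded_linear_graph B, B `<=` G `|` \bigcup_(A in F) A, B z & B w].
    have sub A : F A -> G `|` A `<=` G `|` \bigcup_(A in F) A.
      by move=> FA; apply: setUS; exact: bigcup_sup.
    move=> [Gz|[A FA Az]] [Gw|[B FB Bw]].
    - by exists G; split => //; exact: subsetUl.
    - by exists (G `|` B); split; [exact: FP|exact: sub|left|right].
    - by exists (G `|` A); split; [exact: FP|exact: sub|right|left].
    have [AB|BA] := totF _ _ FA FB.
      by exists (G `|` B); split; [exact: FP|exact: sub|right; exact: AB|right].
    by exists (G `|` A); split; [exact: FP|exact: sub|right|right; exact: BA].
  split=> [a x r y s Gx Gy|x r Gx].
    by have [B [[lB _] BG Bx By]] := mem _ _ Gx Gy; apply: BG; exact: lB.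
  by have [B [[_ bB] BG Bx _]] := mem _ _ Gx Gx; exact: bB.
have [H HE] : exists H, H = G `|` A by exists (G `|` A).
rewrite -HE in PA.
have tot v : exists b, H (v, b).
  have H0 : H (0, 0) by rewrite HE; left.
  have [H' bH' [HH' [b Hb]]] := bounded_linear_graph_extend v PA H0.
  apply: contrapT => /forallNP nH.
  apply: (maxA H').
    rewrite properEneq; split; last by move=> z Az; apply: HH'; rewrite HE; right.
    by apply/eqP => AH; apply: (nH b); rewrite HE; right; rewrite AH.
  rewrite /= (_ : _ `|` _ = H')//; apply: setUidr => z Gz.
  by apply: HH'; rewrite HE; left.
have {tot}[f Hf] := choice tot.
exists f; split=> [a x y|x|x r Gx].
- by apply: (bounded_linear_graph_fun PA (Hf _)); exact: PA.1.
- exact: PA.2.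
- by apply: (bounded_linear_graph_fun PA (Hf _)); rewrite HE; left.
Qed.

End HahnBanach.

Section DualMaps.
Context {R : realType} {V : normedModType R}.
Implicit Types F : dual V.

Lemma dual_ext F1 F2 : (forall x, F1 x = F2 x) -> F1 = F2.
Proof. by move=> h; apply/val_inj/funext. Qed.

Lemma le_dual (F : dual V) x : `|F x| <= `|F| * `|x|.
Proof. exact: le_dual_norm. Qed.

Lemma dual_le F M : 0 <= M -> (forall x, `|F x| <= M * `|x|) -> `|F| <= M.
Proof.
move=> M0 FM; apply: dual_norm_le => x x1; apply: le_trans (FM x) _.
by rewrite ler_piMr.
Qed.

Lemma bounded_dual (f : V -> R^o) M : linear f ->
  (forall x, `|f x| <= M * `|x|) -> exists F : dual V, F =1 f.
Proof.
move=> lf fM.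
pose fl : {linear V -> R^o} := HB.pack f (GRing.isLinear.Build _ _ _ _ f lf).
have fP : f \in @dual_pred R V.
  apply/asboolP; split => //.
  apply: (@bounded_linear_continuous _ _ _ fl); apply/linear_boundedP.
  near=> r => x /=; apply: le_trans (fM x) _.
  by rewrite ler_wpM2r//; near: r; exact: nbhs_pinfty_ge.
by exists (Dual fP).
Unshelve. all: by end_near. Qed.

Lemma dual_almost_norming F e : 0 < e ->
  exists2 x, `|x| <= 1 & `|F| - e <= F x.
Proof.
move=> e0; have [_ [x /= x1 <-] /ltW Fx] := sup_adherent e0 (dual_norm_has_sup F).
have [F0|F0] := leP 0 (F x).
  by exists x => //; rewrite ger0_norm in Fx.
exists (- x); first by rewrite normrN.
have -> : F (- x) = - (F x) by rewrite linearN.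
by rewrite -(ltr0_norm F0).
Qed.

End DualMaps.

(** * Restriction to a subspace, and properties U and SU in terms of norm preserving functionals *)

Section Restriction.
Context {R : realType} {V : normedModType R} (Y : submodClosed V).
Implicit Types F G : dual V.

Lemma dual_restr_exists F :
  exists f : dual (normed_subspace Y), forall y, f y = F (subspace_val y).
Proof.
apply: (@bounded_dual _ _ (fun y => F (subspace_val y)) `|F|).
  by move=> a x y; rewrite -linearP.
by move=> y; exact: le_dual.
Qed.

Definition dual_restr F : dual (normed_subspace Y) :=
  sval (cid (dual_restr_exists F)).

Lemma dual_restrE F y : dual_restr F y = F (subspace_val y).
Proof. by rewrite /dual_restr; case: cid. Qed.

Lemma dual_restrB F G : dual_restr (F - G) = dual_restr F - dual_restr G.
Proof.
apply: dual_ext => y; rewrite dual_restrE.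
by transitivity (dual_restr F y - dual_restr G y) => //; rewrite !dual_restrE.
Qed.

Lemma dual_restrZ a F : dual_restr (a *: F) = a *: dual_restr F.
Proof.
apply: dual_ext => y; rewrite dual_restrE.
by transitivity (a * dual_restr F y) => //; rewrite !dual_restrE.
Qed.

Lemma dual_restr_eq F G :
  (forall y, y \in Y -> F y = G y) <-> dual_restr F = dual_restr G.
Proof.
split=> [FG|FG y yY].
  by apply: dual_ext => y; rewrite !dual_restrE FG//; exact: subspace_valP.
have := congr1 (fun h : dual _ => h (NormedSubspace yY)) FG.
by rewrite /= !dual_restrE.
Qed.

Lemma annihilatorE F : annihilator Y F <-> dual_restr F = 0.
Proof.
split=> [F0|F0 y yY].
  by apply: dual_ext => y; rewrite dual_restrE F0//; exact: subspace_valP.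
have := congr1 (fun h : dual _ => h (NormedSubspace yY)) F0.
by rewrite /= dual_restrE.
Qed.

Lemma le_dual_restr F : `|dual_restr F| <= `|F|.
Proof.
apply: dual_le => // y; rewrite dual_restrE.
by apply: le_trans (le_dual _ _) _.
Qed.

Lemma hahn_banach_dual (f : dual (normed_subspace Y)) :
  exists2 F, dual_restr F = f & `|F| = `|f|.
Proof.
have [||g [lg bg gf]] := @hahn_banach_graph _ V `|f| (normr_ge0 _)
    [set z | exists y : normed_subspace Y, z = (subspace_val y, f y)].
- split=> [a _ _ _ _ [x [-> ->]] [y [-> ->]]|_ _ [x [-> ->]]].
    by exists (a *: x + y); rewrite linearP.
  exact: le_dual.
- by exists 0; rewrite linear0.
have [F Fg] := bounded_dual lg bg.
have Ff : dual_restr F = f.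
  by apply: dual_ext => y; rewrite dual_restrE Fg; apply: gf; exists y.
exists F => //; apply/eqP; rewrite eq_le -{2}Ff le_dual_restr andbT.
by apply: dual_le => // x; rewrite Fg.
Qed.

(** One inequality is enough, the other being [le_dual_restr]. *)
Definition norm_preserving F : Prop := `|F| <= `|dual_restr F|.

Lemma norm_preservingE F : norm_preserving F -> `|dual_restr F| = `|F|.
Proof. by move=> nF; apply/eqP; rewrite eq_le le_dual_restr. Qed.

(** Hahn-Banach provides the existence half of property U, so only uniqueness remains; and [F] is
    norm preserving exactly when it is a norm preserving extension of its own restriction. *)
Lemma property_UP : property_U Y <-> forall F G, norm_preserving F ->
  norm_preserving G -> dual_restr F = dual_restr G -> F = G.
Proof.
split=> [U F G nF nG FG|U f].
  have [H [_ HU]] := U (dual_restr F).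
  rewrite -(HU F); last by split=> [y|]; rewrite ?dual_restrE ?norm_preservingE.
  rewrite -(HU G)//; rewrite FG; split=> [y|]; last by rewrite norm_preservingE.
  by rewrite dual_restrE.
have [F Ff nF] := hahn_banach_dual f.
exists F; split; first by split => // y; rewrite -Ff dual_restrE.
move=> G [Gf nG].
have {}Gf : dual_restr G = f by apply: dual_ext => y; rewrite dual_restrE.
by apply: U; rewrite /norm_preserving ?Gf ?Ff// ?nG ?nF.
Qed.

Lemma norm_preserving_add_closed :
  (forall F G, norm_preserving F -> norm_preserving G -> norm_preserving (F + G)) ->
  submod_closed [pred F : dual V | `[< norm_preserving F >]].
Proof.
move=> nD; split.
  by apply/asboolP; rewrite /norm_preserving normr0.
move=> a F G /asboolP nF /asboolP nG; apply/asboolP; apply: nD => //.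
by rewrite /norm_preserving dual_restrZ !normrZ ler_wpM2l.
Qed.

(** Both norms compared in [norm_preserving] are 1-Lipschitz in [F], so an approximation within
    [e / 2] costs at most [e]. *)
Lemma norm_preserving_closed : closed [set F | norm_preserving F].
Proof.
move=> F clF; apply/ler_addgt0Pr => e e0.
have [G [nG]] := clF _ (nbhsx_ballx F (e / 2) (divr_gt0 e0 (ltr0Sn _ 1))).
rewrite -ball_normE/= => FG.
have h1 : `|F| <= `|F - G| + `|G| by rewrite -{1}(subrK G F) ler_normD.
have h2 : `|dual_restr G| <= `|F - G| + `|dual_restr F|.
  have -> : dual_restr G = dual_restr F - dual_restr (F - G).
    by rewrite dual_restrB opprB addrC subrK.
  by rewrite (le_trans (ler_normB _ _))// addrC lerD2r le_dual_restr.
move: FG h1 h2 (nG : `|G| <= `|dual_restr G|).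
move: `|F - G| `|F| `|G| `|dual_restr F| `|dual_restr G| => a b c f g.
lra.
Qed.

(** The complement [C] can only be the set of norm preserving functionals, which is therefore
    additive. Two of them with the same restriction differ by an element of both [C] and the
    annihilator, that is by 0. *)
Lemma property_SU_norm_preservingD : property_SU Y ->
  property_U Y /\
  forall F G, norm_preserving F -> norm_preserving G -> norm_preserving (F + G).
Proof.
move=> [C [Ccl C0 Cdec] Clt].
have nC F : norm_preserving F <-> F \in C.
  split=> [nF|FC].
    have [g [h [gC hY Fgh]]] := Cdec F.
    have [h0|h0] := eqVneq h 0; first by rewrite Fgh h0 addr0.
    (* Here [|g| < |F| = |dual_restr F| = |dual_restr g| <= |g|], a contradiction. *)
    have := Clt _ _ _ gC hY Fgh h0; rewrite -(norm_preservingE nF).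
    have -> : dual_restr F = dual_restr g.
      apply/dual_restr_eq => y yY; rewrite Fgh.
      by transitivity (g y + h y) => //; rewrite hY// addr0.
    by rewrite ltNge le_dual_restr.
  (* Conversely, compare [F] in [C] with a Hahn-Banach extension [H] of its restriction. Unless
     [H = F], the decomposition [H = F + (H - F)] gives [|F| < |H| = |dual_restr F|]. *)
  have [H HF nH] := hahn_banach_dual (dual_restr F).
  have hY : annihilator Y (H - F) by apply/annihilatorE; rewrite dual_restrB HF subrr.
  have [/eqP|HF0] := eqVneq (H - F) 0.
    by rewrite subr_eq0 => /eqP HFe; rewrite /norm_preserving -{1}HFe nH.
  have := Clt H F (H - F) FC hY _ HF0; rewrite addrC subrK => /(_ erefl).
  by rewrite nH ltNge le_dual_restr.
split=> [|F G /nC FC /nC GC]; last by apply/nC; rewrite rpredD.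
apply/property_UP => F G /nC FC /nC GC FG.
apply/eqP; rewrite -subr_eq0; apply/eqP.
have : ([set` C] `&` annihilator Y) (F - G).
  split; first by rewrite /= -scaleN1r rpredD// rpredZ.
  by apply/annihilatorE; rewrite dual_restrB FG subrr.
by rewrite C0.
Qed.

End Restriction.

Section NormPreservingSubmod.
Context {R : realType} {V : normedModType R} (Y : submodClosed V).
Hypothesis nD : forall F G : dual V, norm_preserving Y F ->
  norm_preserving Y G -> norm_preserving Y (F + G).

(** Additivity is an explicit argument so that inference can attach the submodule structure to the
    predicate. *)
Definition norm_preserving_pred (_ : forall F G : dual V, norm_preserving Y F ->
  norm_preserving Y G -> norm_preserving Y (F + G)) : {pred dual V} :=
  [pred F : dual V | `[< norm_preserving Y F >]].

HB.instance Definition _ := GRing.isSubmodClosed.Build _ _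
  (norm_preserving_pred nD) (norm_preserving_add_closed nD).

Definition norm_preserving_submod : submodClosed (dual V) :=
  norm_preserving_pred nD.

(** To decompose [F], take for [g] a Hahn-Banach extension of the restriction of [F]. The strict
    inequality is uniqueness: [|f| <= |g|] would make [f] norm preserving with the same restriction
    as [g], hence [f = g]. *)
Lemma norm_preservingD_property_SU : property_U Y -> property_SU Y.
Proof.
move=> /property_UP U; exists norm_preserving_submod.
  split.
  - rewrite (_ : [set` _] = [set F | norm_preserving Y F]).
      exact: norm_preserving_closed.
    by apply/seteqP; split=> F /asboolP.
  - apply/seteqP; split=> [F [/asboolP nF /annihilatorE F0]|_ ->] /=.
      by apply/eqP; rewrite -normr_le0; move: nF; rewrite /norm_preserving F0 normr0.
    by split; [exact: rpred0|].
  - move=> F; have [H HF nH] := hahn_banach_dual (dual_restr Y F).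
    exists H, (F - H); split; last by rewrite addrC subrK.
      by apply/asboolP; rewrite /norm_preserving HF nH.
    by apply/annihilatorE; rewrite dual_restrB HF subrr.
move=> f g h /asboolP ng /annihilatorE h0 fgh hn0.
have fg : dual_restr Y f = dual_restr Y g.
  apply/eqP; rewrite -subr_eq0 -dual_restrB; apply/eqP.
  by rewrite fgh addrC addKr.
rewrite ltNge; apply/negP => fleg.
suff fg' : f = g by move: hn0; rewrite -(addKr g h) -fgh fg' addNr eqxx.
by apply: U => //; rewrite /norm_preserving fg; exact: le_trans ng.
Qed.

End NormPreservingSubmod.

Lemma property_SUP (R : realType) (V : normedModType R) (Y : submodClosed V) :
  property_SU Y <-> property_U Y /\ forall F G, norm_preserving Y F ->
    norm_preserving Y G -> norm_preserving Y (F + G).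
Proof.
split=> [|[U nD]]; first exact: property_SU_norm_preservingD.
exact: norm_preservingD_property_SU nD U.
Qed.

(** * Simple functions and Lebesgue norms *)

Section SimpleTheory.
Context d {T : measurableType d} {R : realType}.

Lemma simple_comp_pair {X1 X2 Z : normedModType R} (h : X1 -> X2 -> Z)
    (s1 : T -> X1) (s2 : T -> X2) :
  simple_function s1 -> simple_function s2 ->
  simple_function (fun t => h (s1 t) (s2 t)).
Proof.
move=> ss1 ss2; split.
  apply: (@sub_finite_set _ _ [set h x y | x in range s1 & y in range s2]).
    by move=> _ [x _ <-]; exists (s1 x); [exists x|exists (s2 x) => //; exists x].
  by apply: finite_image2; [case: ss1|case: ss2].
move=> x.
rewrite [X in measurable X](_ : _ = \bigcup_(y in range s1)
  (s1 @^-1` [set y] `&` s2 @^-1` [set z | h y z = x])).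
  apply: fin_bigcup_measurable; first by case: ss1.
  by move=> y _; apply: measurableI; exact: simple_preimage.
apply/seteqP; split=> [u /= hx|u [y _ /= [-> //]]].
by exists (s1 u) => //; exists u.
Qed.

Lemma simple_comp {X Z : normedModType R} (h : X -> Z) (s : T -> X) :
  simple_function s -> simple_function (fun t => h (s t)).
Proof. by move=> ss; exact: (simple_comp_pair (fun x _ => h x) ss ss). Qed.

(** No regularity of [h] is asked: every preimage under [s] is a finite union of measurable
    fibres. *)
Lemma simple_measurable_fun {X : normedModType R} (h : X -> R) (s : T -> X) :
  simple_function s -> measurable_fun setT (fun t => h (s t)).
Proof.
by move=> ss _ B mB; rewrite setTI; exact: (@simple_preimage _ _ _ _ _ (h @^-1` B)).
Qed.

Lemma simple_strongly_measurable {X : normedModType R} (s : T -> X) :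
  simple_function s -> strongly_measurable s.
Proof. by move=> ss; exists (fun=> s) => // t; exact: cvg_cst. Qed.

Lemma simple_bound {X : normedModType R} (s : T -> X) :
  simple_function s -> exists2 M, 0 <= M & forall t, `|s t| <= M.
Proof.
move=> [fs _]; exists (\sum_(x <- fset_set (range s)) `|x|).
  exact: sumr_ge0.
move=> t; rewrite (big_fsetD1 (s t))/=; last first.
  by rewrite in_fset_set// mem_set//; exists t.
by rewrite lerDl sumr_ge0.
Qed.

Lemma simple_indic {X : normedModType R} (E : set T) (x : X) : measurable E ->
  simple_function (fun t => \1_E t *: x).
Proof.
move=> mE; split.
  apply: (@sub_finite_set _ _ [set 0; x]); last exact: finite_set2.
  by move=> _ [t _ <-]; rewrite indicE; case: (t \in E);
    [right; rewrite /= scale1r|left; rewrite /= scale0r].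
move=> y.
have [yx|yx] := pselect (x = y); have [y0|y0] := pselect (0 = y).
- rewrite (_ : _ @^-1` _ = setT)//; apply/seteqP; split=> // t _ /=.
  by rewrite indicE -yx; case: (t \in E); rewrite ?scale1r// scale0r yx.
- rewrite (_ : _ @^-1` _ = E)//; apply/seteqP; split=> t /=.
    by rewrite indicE; case: (boolP (t \in E)) => [/set_mem//|_]; rewrite scale0r.
  by move=> tE; rewrite indicE mem_set// scale1r.
- rewrite (_ : _ @^-1` _ = ~` E); first exact: measurableC.
  apply/seteqP; split=> t /=.
    by rewrite indicE; case: (boolP (t \in E)) => [|/negP + _ tE];
      rewrite ?scale1r// => /(_ (mem_set tE)).
  by move=> tE; rewrite indicE memNset// scale0r.
- rewrite (_ : _ @^-1` _ = set0)//; apply/seteqP; split=> t //=.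
  by rewrite indicE; case: (t \in E); rewrite ?scale1r// scale0r.
Qed.

Lemma simple_decomposition {X : normedModType R} (s : T -> X) t :
  simple_function s ->
  s t = \sum_(x <- fset_set (range s)) \1_(s @^-1` [set x]) t *: x.
Proof.
move=> [fs _]; rewrite (big_fsetD1 (s t))/=; last first.
  by rewrite in_fset_set// mem_set//; exists t.
rewrite indicE mem_set// scale1r big_seq big1 ?addr0// => x.
rewrite !inE => /andP[xs _]; rewrite indicE memNset ?scale0r//=.
by move=> e; rewrite e eqxx in xs.
Qed.

Lemma simple_function_ind {X : normedModType R} (P : (T -> X) -> Prop) :
  (forall E x, measurable E -> P (fun t => \1_E t *: x)) ->
  (forall f g, simple_function f -> simple_function g -> P f -> P g ->
    P (fun t => f t + g t)) ->
  forall s, simple_function s -> P s.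
Proof.
move=> P1 PD s ss.
have -> : s = fun t => \sum_(x <- fset_set (range s)) \1_(s @^-1` [set x]) t *: x.
  by apply/funext => t; rewrite -simple_decomposition.
have P0 : P (fun=> 0).
  rewrite (_ : (fun=> 0) = fun t : T => \1_(set0 : set T) t *: (0 : X)).
    exact: P1.
  by apply/funext => t; rewrite scaler0.
(* Simplicity is carried through the induction because [PD] asks for it of the partial sums. *)
suff [] : simple_function (fun t => \sum_(x <- fset_set (range s))
    \1_(s @^-1` [set x]) t *: x) /\
    P (fun t => \sum_(x <- fset_set (range s)) \1_(s @^-1` [set x]) t *: x) by [].
elim: {1 2}(enum_fset _) => [|x r [IH1 IH2]].
  by under eq_fun do rewrite big_nil; split => //; exact: simple_cst.
have mx : measurable (s @^-1` [set x]) by case: ss.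
under eq_fun do rewrite big_cons; split.
  exact: (simple_comp_pair +%R (simple_indic _ mx)).
by apply: PD => //; [exact: simple_indic|exact: P1].
Qed.

End SimpleTheory.

Section Pairing.
Context d {T : measurableType d} {R : realType} {X : normedModType R}.

Lemma le_pairing (f g : dual X) (x y : X) :
  `|f x - g y| <= `|f - g| * `|x| + `|g| * `|x - y|.
Proof.
have -> : f x - g y = (f - g) x + g (x - y).
  have -> : (f - g) x = f x - g x by [].
  by rewrite linearB addrA subrK.
by apply: le_trans (ler_normD _ _) _; apply: lerD; exact: le_dual.
Qed.

Lemma cvg_pairing (f : nat -> dual X) (g : dual X) (x : nat -> X) (y : X) :
  f n @[n --> \oo] --> g -> x n @[n --> \oo] --> y ->
  (f n (x n) : R) @[n --> \oo] --> (g y : R).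
Proof.
move=> fg xy; apply/cvgrPdistC_le => e e0.
suff : (`|f n - g| * `|x n| + `|g| * `|x n - y|) @[n --> \oo] --> (0 : R).
  move=> /cvgr0_norm_le/(_ e e0); apply: filterS => n.
  rewrite ger0_norm ?addr_ge0 ?mulr_ge0// => h.
  exact: le_trans (le_pairing _ _ _ _) h.
have -> : 0 = `|g - g| * `|y| + `|g| * `|y - y|.
  by rewrite !subrr !normr0 mul0r mulr0 addr0.
apply: cvgD; apply: cvgM; last 2 first.
- exact: cvg_cst.
- by apply: cvg_norm; apply: cvgB; [exact: xy|exact: cvg_cst].
- by apply: cvg_norm; apply: cvgB; [exact: fg|exact: cvg_cst].
- exact: cvg_norm.
Qed.

Lemma measurable_pairing (g : T -> dual X) (u : T -> X) :
  strongly_measurable g -> strongly_measurable u ->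
  measurable_fun setT (fun t => g t (u t) : R).
Proof.
move=> [s ss sg] [v sv vu].
apply: (@measurable_fun_cvg _ _ _ _ (fun n t => s n t (v n t) : R)).
  move=> n; apply: (@simple_measurable_fun _ _ _ _ id (fun t => s n t (v n t) : R^o)).
  exact: (simple_comp_pair (fun (f : dual X) x => f x : R^o)).
by move=> t _; apply: cvg_pairing.
Qed.

Lemma strongly_measurable_lipschitz (Z : normedModType R) (h : X -> Z) (u : T -> X) :
  (forall x y, `|h x - h y| <= `|x - y|) ->
  strongly_measurable u -> strongly_measurable (fun t => h (u t)).
Proof.
move=> hl [s ss su]; exists (fun n t => h (s n t)) => [n|t].
  exact: simple_comp.
apply/cvgrPdist_lt => e e0; move/cvgrPdist_lt : (su t) => /(_ e e0).
by apply: filterS => n; exact: le_lt_trans.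
Qed.

End Pairing.

Section RealLnorm.
Context d {T : measurableType d} {R : realType} (mu : probability T R).
Implicit Types (phi f w v : T -> R) (p q : R).

Lemma le_Lnorm_ae f g p : 1 <= p -> measurable_fun setT f ->
  measurable_fun setT g -> {ae mu, forall t, `|f t| <= g t} ->
  ('N[mu]_p%:E[EFin \o f] <= 'N[mu]_p%:E[EFin \o g])%E.
Proof.
move=> p1 mf mg fg; have p0 : 0 <= p by exact: le_trans p1.
rewrite unlock; apply: gt0_ler_poweR.
- by rewrite invr_ge0.
- by rewrite in_itv/= leey andbT integral_ge0// => *; exact: poweR_ge0.
- by rewrite in_itv/= leey andbT integral_ge0// => *; exact: poweR_ge0.
apply: ae_ge0_le_integral => //.
- by move=> *; exact: poweR_ge0.
- exact/measurable_abse_poweR/measurable_EFinP.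
- by move=> *; exact: poweR_ge0.
- exact/measurable_abse_poweR/measurable_EFinP.
apply: filterS fg => t fgt _.
apply: gt0_ler_poweR => //; rewrite ?in_itv/= ?leey ?lee_fin ?normr_ge0//.
exact: le_trans fgt (ler_norm _).
Qed.

(** Hoelder's inequality bounds the integral of the majorant [w * v] of [|phi|], which gives
    integrability and the estimate at once. *)
Lemma hoelder_pairing p q phi w v : 0 < p -> 0 < q -> p^-1 + q^-1 = 1 ->
  measurable_fun setT phi -> measurable_fun setT w -> measurable_fun setT v ->
  {ae mu, forall t, `|phi t| <= w t * v t} ->
  ('N[mu]_q%:E[EFin \o w] < +oo)%E -> ('N[mu]_p%:E[EFin \o v] < +oo)%E ->
  mu.-integrable setT (EFin \o phi) /\
  `|(\int[mu]_t phi t)%R| <=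
    fine ('N[mu]_q%:E[EFin \o w])%E * fine ('N[mu]_p%:E[EFin \o v])%E.
Proof.
move=> p0 q0 pq mphi mw mv phiwv Nw Nv.
have mwv : measurable_fun setT (fun t => w t * v t) by exact: measurable_funM.
have Nwf : ('N[mu]_q%:E[EFin \o w])%E \is a fin_num.
  by rewrite ge0_fin_numE// Lnorm_ge0.
have Nvf : ('N[mu]_p%:E[EFin \o v])%E \is a fin_num.
  by rewrite ge0_fin_numE// Lnorm_ge0.
have h : (\int[mu]_t `|(EFin \o phi) t| <=
    'N[mu]_q%:E[EFin \o w] * 'N[mu]_p%:E[EFin \o v])%E.
  rewrite addrC in pq.
  apply: le_trans (hoelder mu mw mv q0 p0 pq); rewrite -Lnorm1.
  by apply: le_Lnorm_ae.
have iphi : mu.-integrable setT (EFin \o phi).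
  apply/integrableP; split; first exact/measurable_EFinP.
  by apply: le_lt_trans h _; rewrite lte_mul_pinfty// Lnorm_ge0.
split => //; rewrite -lee_fin EFin_normr_Rintegral// EFinM !fineK//.
apply: le_trans h; apply: le_abse_integral => //.
exact/measurable_EFinP.
Qed.

(** Hoelder's inequality against the constant 1, whose norm is finite since [mu] is a
    probability. *)
Lemma Lnorm1_lty q f : 1 < q -> measurable_fun setT f ->
  ('N[mu]_q%:E[EFin \o f] < +oo)%E -> ('N[mu]_1%:E[EFin \o f] < +oo)%E.
Proof.
move=> q1 mf Nf; have q0 : 0 < q by exact: lt_trans q1.
pose p := (1 - q^-1)^-1.
have p0 : 0 < p by rewrite invr_gt0 subr_gt0 invf_lt1.
have pq : p^-1 + q^-1 = 1 by rewrite invrK subrK.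
have N1 : ('N[mu]_p%:E[EFin \o cst 1%R] < +oo)%E.
  have -> : ('N[mu]_p%:E[EFin \o cst 1%R] = mu setT `^ p^-1)%E := Lnorm_cst1 mu p.
  by rewrite probability_setT poweR1r ltry.
have [|||/integrableP[_]] := @hoelder_pairing p q f (fun t => `|f t|) (cst 1)
    p0 q0 pq mf _ (measurable_cst _) _ _ N1.
- exact: measurableT_comp.
- by apply: aeW => t; rewrite mulr1.
- by rewrite (_ : EFin \o _ = abse \o (EFin \o f))// Lnorm_abse.
by rewrite -Lnorm1.
Qed.

Lemma Lnorm_lty_integrable p f : 0 < p -> measurable_fun setT f ->
  ('N[mu]_p%:E[EFin \o f] < +oo)%E ->
  mu.-integrable setT (EFin \o (fun t => `|f t| `^ p)).
Proof.
move=> p0 mf Nf; apply/integrableP; split.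
  apply/measurable_EFinP/(@measurableT_comp _ _ _ _ _ _ (@powR R ^~ p)).
    exact: measurable_powR.
  exact: measurableT_comp.
under eq_integral do rewrite /= ger0_norm ?powR_ge0// -poweR_EFin.
rewrite -[ltLHS](@poweR_Lnorm _ _ _ mu (EFin \o f)) ?gt_eqF//.
exact: poweR_lty.
Qed.

Lemma Lnorm_le p f e : 0 < p -> 0 <= e ->
  (\int[mu]_t (`|f t| `^ p)%:E <= (e `^ p)%:E)%E ->
  ('N[mu]_p%:E[EFin \o f] <= e%:E)%E.
Proof.
move=> p0 e0 fe; rewrite unlock.
have -> : e%:E = ((e `^ p)%:E `^ p^-1)%E.
  by rewrite poweR_EFin -powRrM mulfV ?gt_eqF// powRr1.
apply: gt0_ler_poweR; rewrite ?invr_ge0 ?(ltW p0)//.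
- by rewrite in_itv/= leey andbT integral_ge0// => *; exact: poweR_ge0.
- by rewrite in_itv/= leey andbT lee_fin powR_ge0.
Qed.

Lemma Lnorm_le_bound p f M : 0 < p -> measurable_fun setT f ->
  (forall t, `|f t| <= M) -> ('N[mu]_p%:E[EFin \o f] <= M%:E)%E.
Proof.
move=> p0 mf fM.
have M0 : 0 <= M by exact: le_trans (normr_ge0 (f point)) _.
apply: Lnorm_le => //.
have -> : ((M `^ p)%:E = \int[mu]_t (cst (M `^ p)%:E t))%E.
  by rewrite integral_cst// -[LHS]mule1 -(probability_setT mu).
apply: ge0_le_integral => //.
  apply/measurable_EFinP/(@measurableT_comp _ _ _ _ _ _ (@powR R ^~ p)).
    exact: measurable_powR.
  exact: measurableT_comp.
by move=> t _; rewrite lee_fin ge0_ler_powR ?nnegrE// ltW.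
Qed.

Lemma Lnorm_lty_bounded p f M : 0 < p -> measurable_fun setT f ->
  (forall t, `|f t| <= M) -> ('N[mu]_p%:E[EFin \o f] < +oo)%E.
Proof.
by move=> p0 mf fM; rewrite (le_lt_trans (Lnorm_le_bound p0 mf fM))// ltry.
Qed.

Lemma Rintegral_ae_eq (f h : T -> R) : measurable_fun setT f ->
  measurable_fun setT h -> {ae mu, forall t, f t = h t} ->
  (\int[mu]_t f t = \int[mu]_t h t)%R.
Proof.
move=> mf mh fh; congr fine; apply: ae_eq_integral => //.
- exact/measurable_EFinP.
- exact/measurable_EFinP.
- by apply: filterS fh => t /= -> .
Qed.

Lemma integrable_bounded_mul (phi f : T -> R) M : measurable_fun setT phi ->
  (forall t, `|phi t| <= M) -> mu.-integrable setT (EFin \o f) ->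
  mu.-integrable setT (EFin \o (fun t => phi t * f t)).
Proof.
move=> mphi phiM fi.
have mf : measurable_fun setT f by apply/measurable_EFinP; exact: measurable_int fi.
apply: (@le_integrable _ _ _ _ _ _ _ (fun t => (M%:E * (EFin \o f) t)%E)) => //.
- by apply/measurable_EFinP; exact: measurable_funM.
- move=> t _; rewrite /= lee_fin !normrM ler_wpM2r// (le_trans (phiM t))//.
  exact: ler_norm.
- exact: integrableZl.
Qed.

End RealLnorm.

Section SimpleDensity.
Context d {T : measurableType d} {R : realType} (mu : probability T R).
Context {X : normedModType R}.

Lemma strongly_measurableB (f g : T -> X) : strongly_measurable f ->
  strongly_measurable g -> strongly_measurable (fun t => f t - g t).
Proof.
move=> sf sg; have := strongly_measurable_lin (-1) sg sf.
by congr strongly_measurable; apply/funext => t /=; rewrite !fctE scaleN1r addrC.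
Qed.

(** The approximations [s n] are replaced by 0 where their norm exceeds twice that of [f]. They
    still converge to [f]: where [f t != 0] the truncation eventually has no effect, and where
    [f t = 0] it gives 0 throughout. Being now dominated by a multiple of [|f|], they fall under
    dominated convergence. *)
Lemma simple_dense p (f : T -> X) e : 1 <= p -> 0 < e -> strongly_measurable f ->
  ('N[mu]_p%:E[(fun t => `|f t|%:E)] < +oo)%E ->
  exists2 s, simple_function s &
    ('N[mu]_p%:E[(fun t => `|f t - s t|%:E)] <= e%:E)%E.
Proof.
move=> p1 e0 sf Nf; have p0 : 0 < p by exact: lt_le_trans p1.
have mf := strongly_measurable_norm sf.
have [s ss sf'] := sf.
pose E n := [set t | `|s n t| <= 2 * `|f t|].
have mE n : measurable (E n).
  rewrite -[E n]setTI; apply: measurable_fun_le => //.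
    exact: strongly_measurable_norm (simple_strongly_measurable (ss n)).
  exact: measurable_funM.
pose v n t := \1_(E n) t *: s n t.
have sv n : simple_function (v n).
  rewrite (_ : v n = fun t => (\1_(E n) t *: (1 : R^o) : R^o) *: s n t); last first.
    by apply/funext => t; rewrite /v /GRing.scale/= mulr1.
  exact: (simple_comp_pair (fun (a : R^o) x => a *: x) (simple_indic _ (mE n))).
have vE n t : v n t = if t \in E n then s n t else 0.
  by rewrite /v indicE; case: (t \in E n); rewrite ?scale1r ?scale0r.
have vf n t : `|v n t| <= 2 * `|f t|.
  rewrite vE; case: ifPn => [/set_mem//|_].
  by rewrite normr0 mulr_ge0.
have vcvg t : v n t @[n --> \oo] --> f t.
  have [ft0|ft0] := eqVneq (f t) 0.
    have v0 n : v n t = 0.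
      by apply/eqP; rewrite -normr_le0 (le_trans (vf n t))// ft0 normr0 mulr0.
    by under eq_fun do rewrite v0; rewrite ft0; exact: cvg_cst.
  apply: cvg_trans (sf' t); apply: near_eq_cvg.
  have : `|f t| < 2 * `|f t| by rewrite ltr_pMl ?normr_gt0// ltr1n.
  move=> /(cvgr_norm_lt _ (sf' t)).
  by apply: filterS => n /ltW nE; rewrite vE mem_set.
have mfv n : measurable_fun setT (fun t => `|f t - v n t|).
  apply: strongly_measurable_norm; apply: strongly_measurableB => //.
  exact: simple_strongly_measurable.
have mfvp n : measurable_fun setT (fun t => (`|f t - v n t| `^ p)%:E).
  apply/measurable_EFinP/(@measurableT_comp _ _ _ _ _ _ (@powR R ^~ p)).
    exact: measurable_powR.
  exact: mfv.
have cv t : ((`|f t - v n t| `^ p)%:E @[n --> \oo] --> 0)%E.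
  apply/fine_cvgP; split; first by apply: nearW.
  apply/cvgr0Pnorm_le => a a0.
  have a1 : 0 < a `^ p^-1 by rewrite powR_gt0.
  have := vcvg t; move=> /cvgrPdist_le/(_ _ a1).
  apply: filterS => n /= h; rewrite ger0_norm ?powR_ge0//.
  have -> : a = (a `^ p^-1) `^ p.
    by rewrite -powRrM mulVf ?gt_eqF// powRr1// ltW.
  by rewrite ge0_ler_powR ?nnegrE ?powR_ge0// ltW.
(* The factor 3 comes from [|f t - v n t| <= |f t| + 2 * |f t|]. *)
have ig : mu.-integrable setT (fun t => ((3 `^ p)%:E * (`|f t| `^ p)%:E)%E).
  apply: integrableZl => //.
  rewrite (_ : (fun t => _) = EFin \o (fun t => `|(fun u => `|f u|) t| `^ p)).
    exact: Lnorm_lty_integrable.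
  by apply/funext => t /=; rewrite normr_id.
have dom n t : (`|(`|f t - v n t| `^ p)%:E| <= (3 `^ p)%:E * (`|f t| `^ p)%:E)%E.
  rewrite gee0_abs ?lee_fin ?powR_ge0// -powRM//.
  rewrite ge0_ler_powR ?nnegrE ?mulr_ge0 ?(ltW p0)//.
  by apply: le_trans (ler_normB _ _) _; have := vf n t; lra.
have [_ + _] := dominated_convergence measurableT mfvp (measurable_cst _)
  (aeW _ (fun t _ => cv t)) ig (aeW _ (fun t n _ => dom n t)).
move=> /fine_cvgP[ffin /cvgr0_norm_le].
have ep : 0 < e `^ p by rewrite powR_gt0.
move=> /(_ _ ep) le_e.
near \oo => n; exists (v n) => //.
apply: (@Lnorm_le _ _ _ mu p (fun t => `|f t - v n t|)) => //; first exact: ltW.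
have fn : ((\int[mu]_x `|(`|f x - v n x| `^ p)%:E - cst 0 x|) \is a fin_num)%E.
  by near: n.
have : `|fine (\int[mu]_x `|(`|f x - v n x| `^ p)%:E - cst 0 x|)%E| <= e `^ p.
  by near: n.
move=> h; have {h} := le_trans (ler_norm _) h.
rewrite -lee_fin fineK//; congr (_ <= _)%E; apply: eq_integral => t _.
by rewrite /= subr0 normr_id ger0_norm ?powR_ge0.
Unshelve. all: by end_near. Qed.

End SimpleDensity.

Lemma dual_restr_lipschitz (R : realType) (V : normedModType R)
    (Y : submodClosed V) (F G : dual V) :
  `|dual_restr Y F - dual_restr Y G| <= `|F - G|.
Proof. by rewrite -dual_restrB le_dual_restr. Qed.

(** * Functionals on [L_p(mu, X)] given by a density in [L_q], and upper bounds for their norms *)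

Section LpPairing.
Context d {T : measurableType d} {R : realType} (mu : probability T R).
Context {X : normedModType R} (p : R) (p1 : 1 <= p).
Local Notation Lp := (Lp mu X p1).

Lemma Lp_exists (f : T -> X) : strongly_measurable f ->
  ('N[mu]_p%:E[(fun t => `|f t|%:E)] < +oo)%E ->
  exists u : Lp, {ae mu, forall t, u t = f t}.
Proof.
move=> sf Nf; have fP : f \in Lpfun_pred mu p1 by apply/asboolP.
by exists (\pi_Lp%qT (LpFun fP)); exact: (Lp_repr (LpFun fP)).
Qed.

Lemma Lp_norm_ae (u : Lp) (f : T -> X) : strongly_measurable f ->
  {ae mu, forall t, u t = f t} ->
  (`|u|%:E = 'N[mu]_p%:E[(fun t => `|f t|%:E)])%E.
Proof.
move=> sf uf; have -> : (`|u|%:E = (Lp_norm u)%:E)%E by [].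
rewrite Lp_normE; apply: ae_eq_Lnorm_normr => //; exact: Lp_fun_sm.
Qed.

Lemma Lp_Lnorm_lty (u : Lp) : ('N[mu]_p%:E[(fun t => `|u t|%:E)] < +oo)%E.
Proof. by rewrite -Lp_normE ltry. Qed.

Section conjugate.
Variables (q : R).
Hypotheses (q1 : 1 <= q) (pq : p^-1 + q^-1 = 1).

Let p0 : 0 < p. Proof. exact: lt_le_trans p1. Qed.
Let q0 : 0 < q. Proof. exact: lt_le_trans q1. Qed.

(** The weight [w] is kept apart from [|g t|]: for the restriction to [L_p(mu, Y)] it is the norm of
    [g t] restricted to [Y], and the pointwise bound then holds only almost everywhere. *)
Lemma pairing_bound (g : T -> dual X) (w : T -> R) (u : Lp) :
  strongly_measurable g -> measurable_fun setT w ->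
  {ae mu, forall t, `|g t (u t)| <= w t * `|u t|} ->
  ('N[mu]_q%:E[EFin \o w] < +oo)%E ->
  mu.-integrable setT (EFin \o (fun t => g t (u t) : R)) /\
  `|(\int[mu]_t (g t (u t) : R))%R| <= fine ('N[mu]_q%:E[EFin \o w])%E * `|u|.
Proof.
move=> sg mw guw Nw.
apply: (@hoelder_pairing _ _ _ mu p q _ w (fun t => `|u t|)) => //.
- by apply: measurable_pairing => //; exact: Lp_fun_sm.
- exact/strongly_measurable_norm/Lp_fun_sm.
- exact: Lp_Lnorm_lty.
Qed.

Lemma pairing_integrable (g : T -> dual X) (u : Lp) :
  strongly_measurable g -> ('N[mu]_q%:E[(fun t => `|g t|%:E)] < +oo)%E ->
  mu.-integrable setT (EFin \o (fun t => g t (u t) : R)).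
Proof.
move=> sg Ng; have [] // := @pairing_bound g (fun t => `|g t|) u sg.
- exact: strongly_measurable_norm.
- by apply: aeW => t; exact: le_dual.
Qed.

Lemma dual_of_pairing (g : T -> dual X) :
  strongly_measurable g -> ('N[mu]_q%:E[(fun t => `|g t|%:E)] < +oo)%E ->
  exists F : dual Lp, forall u : Lp, F u = (\int[mu]_t (g t (u t) : R))%R.
Proof.
move=> sg Ng.
apply: (@bounded_dual _ _ (fun u : Lp => (\int[mu]_t (g t (Lp_fun u t) : R))%R)
  (fine ('N[mu]_q%:E[(fun t => `|g t|%:E)])%E)).
  move=> a u v.
  transitivity (\int[mu]_t (a * g t (Lp_fun u t) + g t (Lp_fun v t)))%R.
    apply: Rintegral_ae_eq.
    - by apply: measurable_pairing => //; exact: Lp_fun_sm.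
    - apply: measurable_funD; first apply: measurable_funM => //.
        by apply: measurable_pairing => //; exact: Lp_fun_sm.
      by apply: measurable_pairing => //; exact: Lp_fun_sm.
    by apply: filterS2 (Lp_funD (a *: u) v) (Lp_funZ a u) => t -> ->; rewrite linearP.
  rewrite RintegralD//.
  - by rewrite RintegralZl//; exact: pairing_integrable.
  - exact: (integrableZl measurableT a (pairing_integrable u sg Ng)).
  - exact: pairing_integrable.
move=> u; have [] // := @pairing_bound g (fun t => `|g t|) u sg.
- exact: strongly_measurable_norm.
- by apply: aeW => t; exact: le_dual.
Qed.

Variable (F : dual Lp) (g : T -> dual X).
Hypotheses (sg : strongly_measurable g)
  (Ng : ('N[mu]_q%:E[(fun t => `|g t|%:E)] < +oo)%E)
  (Fg : forall u : Lp, F u = (\int[mu]_t (g t (u t) : R))%R).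

Lemma le_norm_pairing : `|F| <= fine ('N[mu]_q%:E[(fun t => `|g t|%:E)])%E.
Proof.
apply: dual_le; first by rewrite fine_ge0// Lnorm_ge0.
move=> u; rewrite Fg; have [] // := @pairing_bound g (fun t => `|g t|) u sg.
- exact: strongly_measurable_norm.
- by apply: aeW => t; exact: le_dual.
Qed.

Lemma measurable_norm_restr (Y : submodClosed X) :
  measurable_fun setT (fun t => `|dual_restr Y (g t)|).
Proof.
apply: strongly_measurable_norm; apply: strongly_measurable_lipschitz sg.
exact: dual_restr_lipschitz.
Qed.

Lemma Lnorm_restr_le (Y : submodClosed X) :
  ('N[mu]_q%:E[(fun t => `|dual_restr Y (g t)|%:E)] <=
   'N[mu]_q%:E[(fun t => `|g t|%:E)])%E.
Proof.
apply: (@le_Lnorm_ae _ _ _ mu (fun t => `|dual_restr Y (g t)|)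
  (fun t => `|g t|)) => //.
- exact: measurable_norm_restr.
- exact: strongly_measurable_norm.
by apply: aeW => t; rewrite normr_id le_dual_restr.
Qed.

Lemma le_norm_restr_pairing (Y : submodClosed X) :
  `|dual_restr (Lp_subspace mu p1 Y) F| <=
    fine ('N[mu]_q%:E[(fun t => `|dual_restr Y (g t)|%:E)])%E.
Proof.
apply: dual_le; first by rewrite fine_ge0// Lnorm_ge0.
move=> [u uY]; rewrite dual_restrE/= Fg.
have [] // := @pairing_bound g (fun t => `|dual_restr Y (g t)|) u sg.
- exact: measurable_norm_restr.
- move/asboolP : uY; apply: filterS => t utY.
  by rewrite -(dual_restrE (g t) (NormedSubspace utY)) le_dual.
- exact: le_lt_trans (Lnorm_restr_le _) _.
Qed.

End conjugate.
End LpPairing.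

(** * Norming by simple functions *)

Section LowerNorm.
Import HBNNSimple.
Context d {T : measurableType d} {R : realType} (mu : probability T R).
Context {X : normedModType R} (D : set X) (nu : dual X -> R).
Hypothesis nu_lip : forall f g, `|nu f - nu g| <= `|f - g|.
Hypothesis nu_ge0 : forall f, 0 <= nu f.
Hypothesis nu_le : forall f, nu f <= `|f|.
Hypothesis nu_norming : forall f e, 0 < e ->
  exists x, [/\ D x, `|x| <= 1 & nu f - e <= f x].
Hypothesis DZ : forall a x, D x -> D (a *: x).

Variables (p q : R).
Hypotheses (p1 : 1 <= p) (q1 : 1 < q) (pq : p^-1 + q^-1 = 1).

Let p0 : 0 < p. Proof. exact: lt_le_trans p1. Qed.
Let q0 : 0 < q. Proof. exact: lt_trans q1. Qed.

Variable h : T -> dual X.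
Hypothesis sh : strongly_measurable h.
Hypothesis ih : ('N[mu]_1%:E[(fun t => `|h t|%:E)] < +oo)%E.

Variable C : R.
Hypothesis C0 : 0 <= C.
Hypothesis hC : forall u : T -> X, simple_function u -> (forall t, D (u t)) ->
  (\int[mu]_t (h t (u t) : R))%R <= C * fine ('N[mu]_p%:E[(fun t => `|u t|%:E)])%E.

Let mh : measurable_fun setT (fun t => `|h t|).
Proof. exact: strongly_measurable_norm. Qed.

Let ihn : mu.-integrable setT (EFin \o (fun t => `|h t|)).
Proof.
apply/integrableP; split; first exact/measurable_EFinP.
by move: ih; rewrite Lnorm1.
Qed.

Let mnu : measurable_fun setT (fun t => nu (h t)).
Proof.
have [s ss sh'] := sh.
apply: (@measurable_fun_cvg _ _ _ _ (fun n t => nu (s n t))).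
  by move=> n; exact: simple_measurable_fun.
move=> t _; apply/cvgrPdist_lt => e e0; move/cvgrPdist_lt : (sh' t) => /(_ e e0).
by apply: filterS => n; exact: le_lt_trans.
Qed.

Let inu : mu.-integrable setT (EFin \o (fun t => nu (h t))).
Proof.
apply: le_integrable ihn => //; first exact/measurable_EFinP.
by move=> t _; rewrite /= lee_fin normr_id ger0_norm.
Qed.

(* If [s] is a simple function close to [h] in [L_1] and [y z] almost attains
   [nu z], then [phi t *: y (s t)] is simple and almost norms [phi * nu h]. *)
Lemma lower_norm_weighted (phi : T -> R^o) : simple_function phi ->
  (forall t, 0 <= phi t) ->
  (\int[mu]_t (phi t * nu (h t)))%R <= C * fine ('N[mu]_p%:E[EFin \o phi])%E.
Proof.
move=> sphi phi0; have [M M0 phiM] := simple_bound sphi.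
have mphi : measurable_fun setT phi by exact: (simple_measurable_fun id sphi).
apply/ler_addgt0Pr => e e0.
(* The total error will be [M * e' + 2 * M * e' = 3 * M * e']; the 1 added to [M] keeps the
   denominator positive. *)
have [e' e'E] : exists e', e' = e / (3 * (M + 1)) by eexists.
have M1 : 0 < M + 1 by rewrite ltr_wpDl.
have e'0 : 0 < e' by rewrite e'E divr_gt0// mulr_gt0.
have [s ss hs] := simple_dense (lexx 1) e'0 sh ih.
(* The vector is chosen as a function of the functional [z] and not of [t], so [y (s t)] takes
   finitely many values. *)
pose y z := projT1 (cid (@nu_norming z _ e'0)).
have yP z : [/\ D (y z), `|y z| <= 1 & nu z - e' <= z (y z)].
  by rewrite /y; case: cid.
pose u t := phi t *: y (s t).
have su : simple_function u.
  exact: (simple_comp_pair (fun (a : R^o) z => a *: y z) sphi ss).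
have Du t : D (u t) by apply: DZ; case: (yP (s t)).
have := hC su Du.
have uphi t : `|u t| <= phi t.
  by rewrite normrZ ger0_norm// ler_piMr//; case: (yP (s t)).
have Nphi : ('N[mu]_p%:E[EFin \o phi] < +oo)%E.
  by apply: (Lnorm_lty_bounded mu p0 mphi (M := M)).
have Nu : ('N[mu]_p%:E[(fun t => `|u t|%:E)] <= 'N[mu]_p%:E[EFin \o phi])%E.
  apply: (@le_Lnorm_ae _ _ _ mu (fun t => `|u t|)) => //.
    exact: strongly_measurable_norm (simple_strongly_measurable su).
  by apply: aeW => t; rewrite normr_id.
have Nphif : ('N[mu]_p%:E[EFin \o phi])%E \is a fin_num.
  by rewrite ge0_fin_numE// Lnorm_ge0.
have Nuf : ('N[mu]_p%:E[(fun t => `|u t|%:E)])%E \is a fin_num.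
  by rewrite ge0_fin_numE ?Lnorm_ge0// (le_lt_trans Nu).
have {Nuf Nphif}Nu' : fine ('N[mu]_p%:E[(fun t => `|u t|%:E)])%E <=
   fine ('N[mu]_p%:E[EFin \o phi])%E by rewrite fine_le.
have shs : strongly_measurable (fun t => h t - s t).
  by apply: strongly_measurableB => //; exact: simple_strongly_measurable.
have mhs := strongly_measurable_norm shs.
have ihs : mu.-integrable setT (EFin \o (fun t => `|h t - s t|)).
  apply/integrableP; split; first exact/measurable_EFinP.
  by move: hs; rewrite Lnorm1 => hs; rewrite (le_lt_trans hs)// ltry.
have ihsle : (\int[mu]_t `|h t - s t|)%R <= e'.
  rewrite -lee_fin fineK; last exact: integrable_fin_num.
  move: hs; rewrite Lnorm1; congr (_ <= _)%E; apply: eq_integral => t _.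
  by rewrite /= normr_id.
(* The distance from [h t] to [s t] is paid twice: for replacing [nu (h t)] by [nu (s t)], and for
   evaluating [h t] instead of [s t] at [y (s t)]. *)
have point t : phi t * nu (h t) <=
    h t (u t) + (M * e' + 2 * M * `|h t - s t|).
  have [_ y1 yz] := yP (s t).
  have huE : h t (u t) = phi t * h t (y (s t)) by rewrite linearZ.
  have h1 : s t (y (s t)) - h t (y (s t)) <= `|h t - s t|.
    rewrite distrC; apply: le_trans (ler_norm _) _.
    have -> : s t (y (s t)) - h t (y (s t)) = (s t - h t) (y (s t)) by [].
    by apply: le_trans (le_dual _ _) _; rewrite ler_piMr.
  have h2 : nu (h t) - nu (s t) <= `|h t - s t|.
    by apply: le_trans (ler_norm _) _; exact: nu_lip.
  have h3 : nu (h t) <= h t (y (s t)) + (e' + 2 * `|h t - s t|).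
    by move: h1 h2 yz; lra.
  have := ler_wpM2l (phi0 t) h3; rewrite mulrDr -huE => /le_trans; apply.
  rewrite lerD2l (_ : M * e' + _ = M * (e' + 2 * `|h t - s t|)); last by ring.
  rewrite ler_wpM2r ?addr_ge0 ?mulr_ge0 ?(ltW e'0)//.
  by have := phiM t; rewrite (ger0_norm (phi0 t)).
have ihu : mu.-integrable setT (EFin \o (fun t => h t (u t) : R)).
  apply: (@le_integrable _ _ _ _ _ _ _ (fun t => (M%:E * `|h t|%:E)%E)) => //.
  - by apply/measurable_EFinP/measurable_pairing => //; exact: simple_strongly_measurable.
  - move=> t _; rewrite /= lee_fin normrM normr_id (ger0_norm M0) mulrC.
    apply: le_trans (le_dual _ _) _; rewrite ler_wpM2l//.
    by apply: le_trans (uphi t) _; have := phiM t; rewrite (ger0_norm (phi0 t)).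
  - exact: (integrableZl measurableT M ihn).
have ic : mu.-integrable setT (EFin \o (fun t => M * e' + 2 * M * `|h t - s t|)).
  apply: (@eq_integrable _ _ _ mu _ measurableT
    (cst (M * e')%:E \+ (fun t => (2 * M)%:E * `|h t - s t|%:E))%E) => //.
  apply: integrableD => //; first exact: finite_measure_integrable_cst.
  exact: (integrableZl measurableT (2 * M) ihs).
have key : (\int[mu]_t (phi t * nu (h t)))%R <=
    (\int[mu]_t (h t (u t) : R))%R + (M * e' + 2 * M * e').
  apply: (@le_trans _ _ (\int[mu]_t (h t (u t) +
      (M * e' + 2 * M * `|h t - s t|)))%R).
    apply: le_Rintegral => //.
    - exact: integrable_bounded_mul phiM inu.
    - by apply: (@eq_integrable _ _ _ mu _ measurableT _ _ _ (integrableD measurableT ihu ic)).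
  rewrite RintegralD// lerD2l RintegralD//; last first.
  - exact: (integrableZl measurableT (2 * M) ihs).
  - exact: finite_measure_integrable_cst.
  rewrite Rintegral_cst// RintegralZl//.
  rewrite [fine _](_ : _ = 1) ?mulr1; last exact: (congr1 fine (probability_setT mu)).
  by rewrite lerD2l ler_wpM2l// mulr_ge0.
move=> hCu; apply: le_trans key _; apply: lerD.
  by apply: le_trans hCu _; rewrite ler_wpM2l.
rewrite (_ : M * e' + _ = M * (3 * e')); last by ring.
have -> : 3 * e' = e / (M + 1).
  by rewrite e'E invfM mulrCA mulrA; field; rewrite gt_eqF.
by rewrite mulrA ler_pdivrMr// mulrC ler_pM2l// lerDl.
Qed.

(** Continuity of the power is drawn from differentiability, hence only at [y > 0]; for [y = 0] the
    bounds make every [x n] zero. *)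
Let cvg_powRq (x : nat -> R) (y : R) : 0 <= y -> (forall n, 0 <= x n <= y) ->
  x n @[n --> \oo] --> y -> x n `^ q @[n --> \oo] --> y `^ q.
Proof.
rewrite le_eqVlt => /predU1P[<-|y0] xy cx.
  have x0 n : x n = 0 by apply/eqP; rewrite eq_le andbC; exact: xy.
  by under eq_fun do rewrite x0; exact: cvg_cst.
have cq : {for y, continuous (@powR R ^~ q)}.
  apply: differentiable_continuous; apply/derivable1_diffP.
  by apply: derivable_powR; rewrite in_itv/= y0.
exact: (cvg_comp _ _ cx cq).
Qed.

(* Test against the weights [w n `^ (q - 1)], for simple [w n] increasing to
   [nu h], as in the converse of Hoelder's inequality. *)
Lemma lower_norm : ('N[mu]_q%:E[EFin \o (fun t => nu (h t))] <= C%:E)%E.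
Proof.
have mw : measurable_fun setT (EFin \o (fun t => nu (h t))) by exact/measurable_EFinP.
(* Simple weights are bounded, so that [J] below is finite and can be divided out, although the
   [L_q] norm of [nu h] is not yet known to be finite. *)
pose w n := (fun t => nnsfun_approx measurableT mw n t) : T -> R.
have wcvg t : w n t @[n --> \oo] --> nu (h t).
  have /(_ _ t I) := @cvg_nnsfun_approx _ _ _ setT measurableT _ mw.
  by move=> /(_ (fun _ _ => nu_ge0 _)) /fine_cvgP[].
have wnd : nondecreasing_seq w by exact: nd_nnsfun_approx.
have wle n t : 0 <= w n t <= nu (h t).
  apply/andP; split; first exact: fun_ge0.
  have nd : nondecreasing_seq (fun n => w n t).
    by move=> i j ij; have /lefP := wnd _ _ ij; exact.
  rewrite -(cvg_lim _ (wcvg t))//; apply: nondecreasing_cvgn_le => //.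
  by apply/cvg_ex; exists (nu (h t)); exact: wcvg.
have sw n : simple_function (w n : T -> R^o).
  split; first exact: fimfunP.
  by move=> x; rewrite -[_ @^-1` _]setTI; apply: measurable_funPT.
have mwn n : measurable_fun setT (w n) by exact: (simple_measurable_fun id (sw n)).
(* By this identity the [p]-th power of the weight is [w n t] to the power [q], and the [L_p] norm
   of the weight is [J] to the power [1/p]. *)
have qp : (q - 1) * p = q.
  have e : p * q * (p^-1 + q^-1) = q + p.
    by field; rewrite !gt_eqF.
  by rewrite mulrBl mul1r mulrC -(mulr1 (p * q)) -pq e addrK.
have wq n : mu.-integrable setT (EFin \o (fun t => w n t `^ q)).
  have ss : simple_function (fun t => w n t `^ q : R^o).
    exact: (simple_comp (fun x : R^o => x `^ q : R^o) (sw n)).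
  have [M _ wM] := simple_bound ss.
  have := integrable_bounded_mul (simple_measurable_fun id ss) wM
    (finite_measure_integrable_cst mu 1 measurableT).
  by apply: eq_integrable => // t _; rewrite /= mulr1.
have Jle n : (\int[mu]_t (w n t `^ q))%R <= C `^ q.
  set J := (\int[mu]_t _)%R.
  have J0 : 0 <= J by apply: Rintegral_ge0 => t _; exact: powR_ge0.
  pose phi t : R^o := w n t `^ (q - 1).
  have sphi : simple_function phi.
    exact: (simple_comp (fun x : R^o => x `^ (q - 1) : R^o) (sw n)).
  have phi0 t : 0 <= phi t by exact: powR_ge0.
  have := lower_norm_weighted sphi phi0.
  have -> : fine ('N[mu]_p%:E[EFin \o phi])%E = J `^ p^-1.
    have -> : ('N[mu]_p%:E[EFin \o phi] =
        (\int[mu]_t (w n t `^ q)%:E) `^ p^-1)%E.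
      rewrite unlock; apply: (congr1 (fun z => z `^ p^-1)%E).
      apply: eq_integral => t _.
      by rewrite [LHS]poweR_EFin ger0_norm// /phi -powRrM qp.
    exact: fine_poweR.
  have JC : J <= (\int[mu]_t (phi t * nu (h t)))%R.
    apply: le_Rintegral => //.
      have [M _ phiM] := simple_bound sphi.
      apply: integrable_bounded_mul phiM inu.
      exact: (simple_measurable_fun id sphi).
    move=> t _; have /andP[w0 wn] := wle n t.
    rewrite -(mulr_powRB1 w0 q0) mulrC; exact: ler_wpM2l (phi0 t) _ _ wn.
  move=> /(le_trans JC) JC'.
  (* At this point [J] is at most [C] times its power [1/p]. Once [J = 0] is set aside, division
     leaves its power [1/q] on the left. *)
  have [->|Jn0] := eqVneq J 0; first exact: powR_ge0.
  have Jp : 0 < J by rewrite lt_neqAle eq_sym Jn0.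
  have : J `^ q^-1 <= C.
    rewrite -(@ler_pM2r _ (J `^ p^-1)) ?powR_gt0//.
    by rewrite -powRD ?Jn0 ?implybT// addrC pq powRr1.
  move=> /(@ge0_ler_powR _ q (ltW q0)).
  by rewrite !nnegrE powR_ge0 C0 -powRrM mulVf ?gt_eqF// powRr1//; exact.
apply: Lnorm_le => //.
have mwq n : measurable_fun setT (fun t => (w n t `^ q)%:E) by exact: measurable_int (wq n).
have nd t : setT t -> nondecreasing_seq (fun n => (w n t `^ q)%:E).
  move=> _ m n mn; have /andP[wm0 _] := wle m t; have /andP[wn0 _] := wle n t.
  by rewrite lee_fin ge0_ler_powR ?nnegrE ?(ltW q0)//; have /lefP := wnd _ _ mn; exact.
have limE : (\int[mu]_t limn (fun n => (w n t `^ q)%:E) =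
           \int[mu]_t (`|nu (h t)| `^ q)%:E)%E.
  apply: eq_integral => t _; apply/cvg_lim => //.
  apply/fine_cvgP; split; first exact: nearW.
  by rewrite ger0_norm//; exact: (cvg_powRq (nu_ge0 _) (fun n => wle n t) (wcvg t)).
have cv : (\int[mu]_t (w n t `^ q)%:E @[n --> \oo] -->
    \int[mu]_t (`|nu (h t)| `^ q)%:E)%E.
  rewrite -limE; apply: cvg_monotone_convergence => //.
  by move=> n t _; rewrite lee_fin powR_ge0.
rewrite -(cvg_lim _ cv)//; apply: lime_le.
  by apply/cvg_ex; eexists; exact: cv.
apply: nearW => n; rewrite -[leLHS]fineK ?lee_fin; first exact: Jle.
exact: (integrable_fin_num measurableT (wq n)).
Qed.

End LowerNorm.

(** * The dual of [L_p(mu, X)] *)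

Section VectorMeasure.
Context d {T : measurableType d} {R : realType} (mu : probability T R).
Context {X : normedModType R} (p : R) (p1 : 1 <= p).
Local Notation Lp := (Lp mu X p1).

Let p0 : 0 < p. Proof. exact: lt_le_trans p1. Qed.

Let mN (E : set T) : measurable E -> (mu E \is a fin_num)%E.
Proof. by move=> mE; exact: fin_num_measure. Qed.

Lemma simple_Lnorm_lty (u : T -> X) : simple_function u ->
  ('N[mu]_p%:E[(fun t => `|u t|%:E)] < +oo)%E.
Proof.
move=> su; have [M _ uM] := simple_bound su.
apply: (@Lnorm_lty_bounded _ _ _ mu p (fun t => `|u t|) M) => //.
  exact: strongly_measurable_norm (simple_strongly_measurable su).
by move=> t; rewrite normr_id.
Qed.

Lemma Lp_indic_exists (E : set T) (x : X) : exists u : Lp,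
  measurable E -> {ae mu, forall t, u t = \1_E t *: x}.
Proof.
have [mE|nE] := pselect (measurable E); last by exists 0.
have se := simple_indic x mE.
have [u uE] := Lp_exists p1 (simple_strongly_measurable se) (simple_Lnorm_lty se).
by exists u.
Qed.

(* An arbitrary element when [E] is not measurable, and likewise for
   [dual_measure] below. *)
Definition Lp_indic E x : Lp := sval (cid (Lp_indic_exists E x)).

Lemma Lp_indicE E x : measurable E ->
  {ae mu, forall t, Lp_indic E x t = \1_E t *: x}.
Proof. by move=> mE; rewrite /Lp_indic; case: cid => u /= uE; exact: uE. Qed.

Lemma Lp_indic_norm E x : measurable E ->
  `|Lp_indic E x| <= fine (mu E) `^ p^-1 * `|x|.
Proof.
move=> mE; have se := simple_indic x mE.
rewrite -lee_fin (Lp_norm_ae (simple_strongly_measurable se) (Lp_indicE x mE)).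
apply: (@Lnorm_le _ _ _ mu p (fun t => `|\1_E t *: x|)) => //.
  by rewrite mulr_ge0 ?powR_ge0.
rewrite (eq_integral (fun t => (`|x| `^ p)%:E * (\1_E t)%:E)%E); last first.
  move=> t _; rewrite normr_id normrZ indicE -EFinM.
  by case: (t \in E); rewrite ?normr1 ?normr0 ?mul1r ?mul0r ?mulr1 ?mulr0 ?powR0 ?gt_eqF.
rewrite ge0_integralZl//; last exact/measurable_EFinP/measurable_indic.
rewrite integral_indic// setIT powRM ?powR_ge0//.
rewrite -powRrM mulVf ?gt_eqF// powRr1 ?fine_ge0// EFinM fineK ?mN// muleC.
by [].
Qed.

Lemma Lp_indicP E a x y : measurable E ->
  Lp_indic E (a *: x + y) = a *: Lp_indic E x + Lp_indic E y.
Proof.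
move=> mE; apply/Lp_eqP.
have := Lp_indicE x mE; apply: filter_app.
have := Lp_indicE y mE; apply: filter_app.
have := Lp_indicE (a *: x + y) mE; apply: filter_app.
apply: filterS2 (Lp_funD (a *: Lp_indic E x) (Lp_indic E y))
  (Lp_funZ a (Lp_indic E x)) => t -> -> -> -> ->.
by rewrite scalerDr !scalerA mulrC.
Qed.

Lemma Lp_indicU A B x : measurable A -> measurable B -> A `&` B = set0 ->
  Lp_indic (A `|` B) x = Lp_indic A x + Lp_indic B x.
Proof.
move=> mA mB AB; apply/Lp_eqP.
have := Lp_indicE x mA; apply: filter_app.
have := Lp_indicE x mB; apply: filter_app.
have := Lp_indicE x (measurableU _ _ mA mB); apply: filter_app.
apply: filterS (Lp_funD (Lp_indic A x) (Lp_indic B x)) => t -> -> -> ->.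
rewrite -scalerDl !indicE in_setU; congr (_ *: _).
have [tA|tA] := boolP (t \in A); have [tB|tB] := boolP (t \in B);
  rewrite ?addr0 ?add0r//.
have : (A `&` B) t by split; exact: set_mem.
by rewrite AB.
Qed.

Variable F : dual Lp.

Lemma dual_indic_exists (E : set T) : exists G : dual X,
  measurable E -> forall x, G x = F (Lp_indic E x).
Proof.
have [mE|nE] := pselect (measurable E); last by exists 0.
have [||G GE] := @bounded_dual _ _ (fun x => F (Lp_indic E x))
    (`|F| * fine (mu E) `^ p^-1).
- by move=> a x y; rewrite Lp_indicP// linearP.
- move=> x; apply: le_trans (le_dual _ _) _.
  by rewrite -mulrA ler_wpM2l// Lp_indic_norm.
by exists G => _ x; rewrite GE.
Qed.

Definition dual_measure E : dual X := sval (cid (dual_indic_exists E)).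

Lemma dual_measureE E x : measurable E -> dual_measure E x = F (Lp_indic E x).
Proof. by move=> mE; rewrite /dual_measure; case: cid => G /= GE; rewrite GE. Qed.

Lemma dual_measure_norm E : measurable E ->
  `|dual_measure E| <= `|F| * fine (mu E) `^ p^-1.
Proof.
move=> mE; apply: dual_le; first by rewrite mulr_ge0 ?powR_ge0.
move=> x; rewrite dual_measureE//; apply: le_trans (le_dual _ _) _.
by rewrite -mulrA ler_wpM2l// Lp_indic_norm.
Qed.

Lemma dual_measureU A B : measurable A -> measurable B -> A `&` B = set0 ->
  dual_measure (A `|` B) = dual_measure A + dual_measure B.
Proof.
move=> mA mB AB; apply: dual_ext => x.
have -> : (dual_measure A + dual_measure B) x = dual_measure A x + dual_measure B x by [].
rewrite !dual_measureE//; last exact: measurableU.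
by rewrite Lp_indicU// linearD.
Qed.

Lemma dual_measure0 : dual_measure set0 = 0.
Proof.
apply/eqP; rewrite -normr_le0; apply: le_trans (dual_measure_norm _) _ => //.
by rewrite measure0 powR0 ?mulr0// gt_eqF// invr_gt0.
Qed.

Lemma dual_measure_small e : 0 < e -> exists2 delta : R, 0 < delta &
  forall E, measurable E -> (mu E < delta%:E)%E -> `|dual_measure E| < e.
Proof.
move=> e0; have F1 : 0 < `|F| + 1 by rewrite ltr_wpDl.
have eF : 0 < e / (`|F| + 1) by rewrite divr_gt0.
(* With this [delta] the bound [dual_measure_norm] stays below [e]; the added 1 keeps the
   denominator positive and the inequality strict. *)
exists ((e / (`|F| + 1)) `^ p); first by rewrite powR_gt0.
move=> E mE muE; apply: le_lt_trans (dual_measure_norm mE) _.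
have muE' : fine (mu E) `^ p^-1 <= e / (`|F| + 1).
  have -> : e / (`|F| + 1) = ((e / (`|F| + 1)) `^ p) `^ p^-1.
    by rewrite -powRrM mulfV ?gt_eqF// powRr1// ltW.
  rewrite ge0_ler_powR ?nnegrE ?invr_ge0 ?fine_ge0 ?powR_ge0 ?(ltW p0)//.
  by rewrite -lee_fin fineK ?mN// ltW.
apply: le_lt_trans (ler_wpM2l (normr_ge0 F) muE') _.
by rewrite mulrCA gtr_pMr// ltr_pdivrMr// mul1r ltrDl.
Qed.

(** Finite additivity reduces the claim to the tails of the union. They decrease to the empty set,
    so their [mu] measure tends to 0 and [dual_measure_small] applies. *)
Lemma dual_measure_vector_measure : vector_measure dual_measure.
Proof.
move=> E mE tE.
have mS n : measurable (\big[setU/set0]_(i < n) E i) by exact: bigsetU_measurable.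
have mB : measurable (\bigcup_i E i) by exact: bigcup_measurable.
have sumE n : \sum_(i < n) dual_measure (E i) =
    dual_measure (\big[setU/set0]_(i < n) E i).
  elim: n => [|n IH]; first by rewrite !big_ord0 dual_measure0.
  rewrite !big_ord_recr/= IH dual_measureU//; first exact: mS.
  rewrite -subset0 => t []; rewrite -bigcup_mkord => -[i /= ilt Ei] En.
  by have := tE i n I I (ex_intro _ t (conj Ei En)) => ieq; rewrite ieq ltnn in ilt.
under eq_fun do rewrite sumE.
have diff n : dual_measure (\bigcup_i E i) - dual_measure (\big[setU/set0]_(i < n) E i) =
    dual_measure (\bigcup_i E i `\` \big[setU/set0]_(i < n) E i).
  have mD := measurableD mB (mS n).
  have SB : \big[setU/set0]_(i < n) E i `<=` \bigcup_i E i.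
    by rewrite -bigcup_mkord => t [i _ Et]; exists i.
  rewrite -{1}(setDKU SB) dual_measureU ?addrK//.
  by rewrite -subset0 => t [[]].
apply/cvgrPdist_lt => e e0.
have [delta d0 small] := dual_measure_small e0.
have cvmu : (mu (\bigcup_i E i `\` \big[setU/set0]_(i < n) E i) @[n --> \oo] --> 0)%E.
  pose D n := \bigcup_i E i `\` \big[setU/set0]_(i < n) E i.
  have mD n : measurable (D n) by exact: measurableD.
  have D0 : \bigcap_n D n = set0.
    rewrite -subset0 => t h; have [[i _ Ei] _] := h 0%N I.
    by have [_] := h i.+1 I; apply; rewrite -bigcup_mkord; exists i => /=.
  have := @nonincreasing_cvg_mu _ _ _ mu D; rewrite D0 measure0; apply => //.
    by rewrite -ge0_fin_numE// mN.
  move=> m n mn; apply/subsetPset => t [Et nS]; split => //; apply: contra_not nS.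
  rewrite -!bigcup_mkord => -[i /= im Ei]; exists i => //=.
  exact: leq_trans mn.
have /fine_cvgP[_ /cvgr0_norm_lt/(_ _ d0)] := cvmu.
apply: filterS => n /= h; rewrite diff; apply: small; first exact: measurableD.
rewrite -(@fineK _ (mu _)) ?mN ?lte_fin//; last exact: measurableD.
by apply: le_lt_trans (ler_norm _) h.
Qed.

(** The norm of [F] bounds the variation. Choose [x i] in the unit ball almost norming
    [dual_measure (E i)]: since the [E i] are disjoint, the sum of the [\1_(E i) t *: x i] has norm
    at most 1 at every [t], hence in [L_p] of a probability, and [F] maps it to the sum of the
    [dual_measure (E i) (x i)]. *)
Lemma dual_measure_variation : variation_bounded dual_measure.
Proof.
exists `|F| => n E mE tE _.
apply/ler_addgt0Pr => e e0.
(* The denominator is [n.+1] because [n] may be 0. *)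
have e' : 0 < e / n.+1%:R by rewrite divr_gt0.
pose x i := projT1 (cid2 (dual_almost_norming (dual_measure (E i)) e')).
have xP i : `|x i| <= 1 /\ `|dual_measure (E i)| - e / n.+1%:R <= dual_measure (E i) (x i).
  by rewrite /x; case: cid2.
have le1 : `|\sum_(i < n) Lp_indic (E i) (x i)| <= 1.
  pose f i (t : T) := \1_(E i) t *: x i.
  have sf i : simple_function (f i) by exact: simple_indic.
  (* [K] ties a class to a simple function defined everywhere, on which the pointwise bound can be
     checked. *)
  pose K (u : Lp) (g : T -> X) := simple_function g /\ {ae mu, forall t, u t = g t}.
  have : K (\sum_(i < n) Lp_indic (E i) (x i)) (\sum_(i < n) f i).
    apply: (@big_ind2 _ _ K).
    - by split; [exact: simple_cst|exact: Lp_fun0].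
    - move=> u1 g1 u2 g2 [sg1 ug1] [sg2 ug2]; split.
        exact: (simple_comp_pair +%R sg1 sg2).
      have := ug1; apply: filter_app; have := ug2; apply: filter_app.
      by apply: filterS (Lp_funD u1 u2) => t -> -> ->.
    - by move=> i _; split => //; exact: Lp_indicE.
  move=> [sg ug].
  rewrite -lee_fin (Lp_norm_ae (simple_strongly_measurable sg) ug).
  apply: (@Lnorm_le_bound _ _ _ mu p (fun t => `|(\sum_(i < n) f i) t|)) => //.
    exact: strongly_measurable_norm (simple_strongly_measurable sg).
  move=> t; rewrite normr_id fct_sumE.
  have [[i Eit]|nE] := pselect (exists i, E i t).
    rewrite (bigD1 i)//= big1 ?addr0.
      by rewrite /f indicE mem_set// scale1r; case: (xP i).
    move=> j ji; rewrite /f indicE memNset ?scale0r// => Ejt.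
    by move/eqP : ji; apply; apply: tE => //; exists t.
  rewrite big1 ?normr0// => i _; rewrite /f indicE memNset ?scale0r// => Eit.
  by apply: nE; exists i.
apply: (@le_trans _ _ (\sum_(i < n) (dual_measure (E i) (x i) + e / n.+1%:R))).
  by apply: ler_sum => i _; rewrite -lerBlDr; case: (xP i).
rewrite big_split/= sumr_const card_ord.
apply: lerD.
  under eq_bigr do rewrite dual_measureE//.
  rewrite -linear_sum; apply: le_trans (ler_norm _) _.
  by apply: le_trans (le_dual _ _) _; rewrite ler_piMr.
rewrite -(mulr_natr (e / _)) -mulrA ler_piMr ?(ltW e0)// mulrC ler_pdivrMr// mul1r.
by rewrite ler_nat.
Qed.

End VectorMeasure.

(** * Evaluation of a Bochner integral of functionals at a vector *)

Section BochnerPairing.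
Context d {T : measurableType d} {R : realType} (mu : probability T R).
Context {X : normedModType R}.

Lemma dual_sumE (I : Type) (r : seq I) (f : I -> dual X) x :
  (\sum_(i <- r) f i) x = \sum_(i <- r) f i x.
Proof. by elim/big_rec2 : _ => // i y g _ <-. Qed.

Lemma integrable_Rsum (I : Type) (r : seq I) (f : I -> T -> R) :
  (forall i, mu.-integrable setT (EFin \o f i)) ->
  mu.-integrable setT (EFin \o (fun t => \sum_(i <- r) f i t)) /\
  (\int[mu]_t (\sum_(i <- r) f i t))%R = \sum_(i <- r) (\int[mu]_t f i t)%R.
Proof.
move=> fi; elim: r => [|i r [IH1 IH2]].
  under eq_fun do rewrite big_nil; rewrite big_nil; split; first exact: integrable0.
  by rewrite Rintegral_cst// mul0r.
rewrite big_cons -IH2 -RintegralD//; split.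
  by under eq_fun do rewrite big_cons; exact: (integrableD measurableT (fi i) IH1).
by apply: eq_Rintegral => t _; rewrite big_cons.
Qed.

Lemma Rintegral_indic (A : set T) : measurable A ->
  mu.-integrable setT (EFin \o (\1_A : T -> R)) /\
  (\int[mu]_t \1_A t)%R = fine (mu A).
Proof.
move=> mA; split; first exact: integrable_indic.
by rewrite /Rintegral integral_indic// setIT.
Qed.

Lemma simple_integral_pairing E (s : T -> dual X) x : measurable E ->
  simple_function s ->
  simple_integral mu E s x = (\int[mu]_t (\1_E t * s t x))%R.
Proof.
move=> mE ss; have [fs ms] := ss.
have mI z : measurable (s @^-1` [set z] `&` E) by exact: measurableI.
rewrite /simple_integral fsbig_finite//= dual_sumE.
transitivity (\int[mu]_t (\sum_(z <- fset_set (range s))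
    z x * \1_(s @^-1` [set z] `&` E) t))%R.
  rewrite (@integrable_Rsum _ _ _ _).2.
    apply: eq_bigr => z _; rewrite RintegralZl//; last exact: (Rintegral_indic (mI z)).1.
    by rewrite (Rintegral_indic (mI z)).2 mulrC.
  move=> z; exact: (integrableZl measurableT (z x) (Rintegral_indic (mI z)).1).
apply: eq_Rintegral => t _; rewrite [in RHS](simple_decomposition t ss) dual_sumE mulr_sumr.
apply: eq_bigr => z _; rewrite indicI/= mulrC mulrAC mulrC.
by congr (_ * _); rewrite mulrC.
Qed.

(** Evaluation at [x] commutes with the integral of a simple function. Passing to the limit costs
    [|x|] times the distance from [z] to the integral of [s n] and [|x|] times the [L_1] distance
    from [g] to [s n], each made at most [e / 2]. *)
Lemma has_bochner_integral_pairing E (g : T -> dual X) z x : measurable E ->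
  strongly_measurable g -> ('N[mu]_1%:E[(fun t => `|g t|%:E)] < +oo)%E ->
  has_bochner_integral mu E g z -> z x = (\int[mu]_t (\1_E t * g t x))%R.
Proof.
move=> mE sg Ng [s [ss gs sz]].
apply/eqP; rewrite -subr_eq0 -normr_le0; apply/ler_addgt0Pr => e e0; rewrite add0r.
have e'0 : 0 < e / 2 / (`|x| + 1) by rewrite divr_gt0 ?ltr_wpDl// divr_gt0.
have x1 : 0 < `|x| + 1 by rewrite ltr_wpDl.
have /fine_cvgP[gfin /cvgr0_norm_le/(_ _ e'0) gs'] := gs.
move/cvgrPdist_le : sz => /(_ _ e'0) sz.
near \oo => n.
have h1 : `|z - simple_integral mu E (s n)| <= e / 2 / (`|x| + 1) by near: n.
have fin : (\int[mu]_t `|g t - s n t|%:E)%E \is a fin_num by near: n.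
have h2 : `|fine (\int[mu]_t `|g t - s n t|%:E)%E| <= e / 2 / (`|x| + 1) by near: n.
have sgs : strongly_measurable (fun t => g t - s n t).
  by apply: strongly_measurableB => //; exact: simple_strongly_measurable.
have igs : mu.-integrable setT (EFin \o (fun t => `|g t - s n t|)).
  apply/integrableP; split; first exact/measurable_EFinP/strongly_measurable_norm.
  by under eq_integral do rewrite /= normr_id; rewrite -ge0_fin_numE// integral_ge0.
have meas (v : T -> dual X) : strongly_measurable v ->
    measurable_fun setT (fun t => \1_E t * v t x).
  move=> sv; apply: measurable_funM; first exact: measurable_indic.
  by apply: measurable_pairing => //; apply: simple_strongly_measurable; exact: simple_cst.
have pt (v : T -> dual X) t : `|\1_E t * v t x| <= `|x| * `|v t|.
  rewrite normrM mulrC [leRHS]mulrC; apply: le_trans (le_dual _ _); rewrite ler_piMr//.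
  by rewrite indicE; case: (t \in E); rewrite ?normr1 ?normr0.
have int (v : T -> dual X) : strongly_measurable v ->
    mu.-integrable setT (EFin \o (fun t => `|v t|)) ->
    mu.-integrable setT (EFin \o (fun t => \1_E t * v t x)).
  move=> sv iv; apply: le_integrable (integrableZl measurableT `|x| iv) => //.
    exact/measurable_EFinP/meas.
  by move=> t _; rewrite /= lee_fin; apply: le_trans (pt v t) _; exact: ler_norm.
have ig : mu.-integrable setT (EFin \o (fun t => `|g t|)).
  apply/integrableP; split; first exact/measurable_EFinP/strongly_measurable_norm.
  by move: Ng; rewrite Lnorm1.
have is_ : mu.-integrable setT (EFin \o (fun t => `|s n t|)).
  apply/integrableP; split.
    exact/measurable_EFinP/strongly_measurable_norm/simple_strongly_measurable.
  by have := simple_Lnorm_lty mu (lexx 1) (ss n); rewrite Lnorm1.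
have igx := int g sg ig.
have isx := int (s n) (simple_strongly_measurable (ss n)) is_.
have diff : `|(\int[mu]_t (\1_E t * s n t x))%R - (\int[mu]_t (\1_E t * g t x))%R| <=
    `|x| * fine (\int[mu]_t `|g t - s n t|%:E)%E.
  rewrite distrC -RintegralB//.
  have -> : (\int[mu]_t (\1_E t * g t x - \1_E t * s n t x) =
      \int[mu]_t (\1_E t * (g t - s n t) x))%R.
    by apply: eq_Rintegral => t _; rewrite -mulrBr.
  apply: (le_trans (le_normr_Rintegral measurableT (int _ sgs igs))).
  rewrite -[X in _ * X]/(\int[mu]_t `|g t - s n t|)%R -RintegralZl//.
  apply: le_Rintegral => //.
  - exact: (integrable_norm (int _ sgs igs)).
  - exact: (integrableZl measurableT `|x| igs).
  - by move=> t _; exact: (pt (fun t => g t - s n t) t).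
have h3 : `|z x - simple_integral mu E (s n) x| <= e / 2.
  have -> : z x - simple_integral mu E (s n) x = (z - simple_integral mu E (s n)) x by [].
  apply: le_trans (le_dual _ _) _; move: h1; rewrite ler_pdivlMr// => /(le_trans _); apply.
  by rewrite ler_wpM2l// lerDl.
have h4 : `|x| * fine (\int[mu]_t `|g t - s n t|%:E)%E <= e / 2.
  move: (le_trans (ler_norm _) h2); rewrite ler_pdivlMr// => /(le_trans _); apply.
  rewrite mulrC; apply: ler_wpM2l; last by rewrite lerDl.
  by rewrite fine_ge0// integral_ge0.
move: h3; rewrite (simple_integral_pairing x mE (ss n)) => h3.
rewrite [e]splitr; apply: le_trans (lerD h3 (le_trans diff h4)).
by apply: le_trans (ler_normD _ _); rewrite addrA subrK.
Unshelve. all: by end_near. Qed.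

End BochnerPairing.

(** * Density of simple functions, and lower bounds for the norms of functionals *)

Section Representation.
Context d {T : measurableType d} {R : realType} (mu : probability T R).
Context {X : normedModType R} (p q : R) (p1 : 1 <= p).
Hypotheses (q1 : 1 < q) (pq : p^-1 + q^-1 = 1).
Local Notation Lp := (Lp mu X p1).

Let p0 : 0 < p. Proof. exact: lt_le_trans p1. Qed.
Let q0 : 0 < q. Proof. exact: lt_trans q1. Qed.

Lemma Lp_simple (u : T -> X) : simple_function u ->
  exists U : Lp, {ae mu, forall t, U t = u t}.
Proof.
move=> su; apply: Lp_exists; first exact: simple_strongly_measurable.
exact: simple_Lnorm_lty.
Qed.

Lemma simple_dense_Lp (u : Lp) e : 0 < e -> exists s, exists S : Lp,
  [/\ simple_function s, {ae mu, forall t, S t = s t} & `|u - S| <= e].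
Proof.
move=> e0; have [s ss us] := simple_dense p1 e0 (Lp_fun_sm u) (Lp_Lnorm_lty u).
have [S Ss] := Lp_simple ss.
exists s, S; split => //; rewrite -lee_fin.
rewrite (@Lp_norm_ae _ _ _ mu _ _ p1 (u - S) (fun t => u t - s t))//.
  by apply: strongly_measurableB; [exact: Lp_fun_sm|exact: simple_strongly_measurable].
have := Ss; apply: filter_app; rewrite -scaleN1r.
apply: filterS2 (Lp_funD u (-1 *: S)) (Lp_funZ (-1) S) => t -> -> ->.
by rewrite scaleN1r.
Qed.

Lemma dual_Lp_eq (F G : dual Lp) :
  (forall s (S : Lp), simple_function s -> {ae mu, forall t, S t = s t} -> F S = G S) ->
  F = G.
Proof.
move=> FG; apply: dual_ext => u; apply/eqP; rewrite -subr_eq0 -normr_le0.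
apply/ler_addgt0Pr => e e0; rewrite add0r.
have n1 : 0 < `|F - G| + 1 by rewrite ltr_wpDl.
have [s [S [ss Ss uS]]] := simple_dense_Lp u (divr_gt0 e0 n1).
have -> : F u - G u = (F - G) (u - S).
  have -> : (F - G) (u - S) = F (u - S) - G (u - S) by [].
  have -> : F (u - S) = F u - F S by exact: linearB.
  have -> : G (u - S) = G u - G S by exact: linearB.
  by rewrite (FG s S)// opprB addrA subrK.
apply: le_trans (le_dual _ _) _.
apply: (@le_trans _ _ ((`|F - G| + 1) * `|u - S|)).
  by rewrite ler_wpM2r// lerDl.
by rewrite mulrC -ler_pdivlMr.
Qed.

(** [lower_norm] for [D = Y]. Its constant can be the norm of the restriction, as a simple function
    with values in [Y] has its class in [L_p(mu, Y)]. *)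
Lemma ge_norm_restr_pairing (F : dual Lp) (g : T -> dual X) (Y : submodClosed X) :
  strongly_measurable g -> ('N[mu]_q%:E[(fun t => `|g t|%:E)] < +oo)%E ->
  (forall u : Lp, F u = (\int[mu]_t (g t (u t) : R))%R) ->
  ('N[mu]_q%:E[(fun t => `|dual_restr Y (g t)|%:E)] <=
    `|dual_restr (Lp_subspace mu p1 Y) F|%:E)%E.
Proof.
move=> sg Ng Fg.
apply: (@lower_norm _ _ _ mu _ [set` Y] (fun f => `|dual_restr Y f|) _ _ _ _ _
  p q p1 q1 pq g sg) => //.
- by move=> f h; apply: le_trans (ler_dist_dist _ _) _; exact: dual_restr_lipschitz.
- by move=> f; exact: le_dual_restr.
- move=> f e e0; have [y y1 fy] := dual_almost_norming (dual_restr Y f) e0.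
  exists (subspace_val y); split; [exact: subspace_valP|exact: y1|].
  by rewrite -dual_restrE.
- by move=> a x Yx; exact: rpredZ.
- by apply: (Lnorm1_lty q1) => //; exact: strongly_measurable_norm.
move=> u su uY; have [U Uu] := Lp_simple su.
have UY : U \in Lp_subspace mu p1 Y by apply/asboolP; apply: filterS Uu => t ->; exact: uY.
have -> : (\int[mu]_t (g t (u t) : R))%R = F U.
  rewrite Fg; apply: Rintegral_ae_eq.
  - by apply: measurable_pairing => //; exact: simple_strongly_measurable.
  - by apply: measurable_pairing => //; exact: Lp_fun_sm.
  - by apply: filterS Uu => t ->.
rewrite -(Lp_norm_ae (simple_strongly_measurable su) Uu)/=.
rewrite -(dual_restrE F (NormedSubspace UY)).
by apply: le_trans (ler_norm _) _; exact: le_dual.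
Qed.

(** The assumptions are what the Radon-Nikodym property delivers, a density in [L_1] and the formula
    on simple functions; the conclusion moves [g] into [L_q]. *)
Lemma ge_norm_pairing (F : dual Lp) (g : T -> dual X) :
  strongly_measurable g -> ('N[mu]_1%:E[(fun t => `|g t|%:E)] < +oo)%E ->
  (forall s (S : Lp), simple_function s -> {ae mu, forall t, S t = s t} ->
    F S = (\int[mu]_t (g t (s t) : R))%R) ->
  ('N[mu]_q%:E[(fun t => `|g t|%:E)] <= `|F|%:E)%E.
Proof.
move=> sg Ng Fg.
apply: (@lower_norm _ _ _ mu _ setT (fun f => `|f|) _ _ _ _ _
  p q p1 q1 pq g sg) => //.
- by move=> f h; exact: ler_dist_dist.
- move=> f e e0; have [y y1 fy] := dual_almost_norming f e0.
  by exists y.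
move=> u su _; have [U Uu] := Lp_simple su.
rewrite -(Fg u U)// -(Lp_norm_ae (simple_strongly_measurable su) Uu)/=.
by apply: le_trans (ler_norm _) _; exact: le_dual.
Qed.

End Representation.

Section RNPRepresentation.
Context d {T : measurableType d} {R : realType} (mu : probability T R).
Context {X : normedModType R} (p q : R) (p1 : 1 <= p).
Hypotheses (q1 : 1 < q) (pq : p^-1 + q^-1 = 1).
Local Notation Lp := (Lp mu X p1).
Hypothesis dualX_RNP : radon_nikodym_property (dual X).

(** While [g] is known to be in [L_1] only, the boundedness of [s] replaces Hoelder's inequality. *)
Lemma pairing_integrable_simple (g : T -> dual X) (s : T -> X) :
  strongly_measurable g -> ('N[mu]_1%:E[(fun t => `|g t|%:E)] < +oo)%E ->
  simple_function s -> mu.-integrable setT (EFin \o (fun t => g t (s t) : R)).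
Proof.
move=> sg Ng ss; have [M M0 sM] := simple_bound ss.
have ig : mu.-integrable setT (EFin \o (fun t => `|g t|)).
  apply/integrableP; split; first exact/measurable_EFinP/strongly_measurable_norm.
  by move: Ng; rewrite Lnorm1.
apply: le_integrable (integrableZl measurableT M ig) => //.
  by apply/measurable_EFinP/measurable_pairing => //; exact: simple_strongly_measurable.
move=> t _; rewrite /= lee_fin; apply: le_trans (ler_norm _).
by apply: le_trans (le_dual _ _) _; rewrite mulrC ler_wpM2r.
Qed.

Theorem dual_Lp_representation (F : dual Lp) : exists g : T -> dual X,
  [/\ strongly_measurable g, ('N[mu]_q%:E[(fun t => `|g t|%:E)] <= `|F|%:E)%E &
  forall u : Lp, F u = (\int[mu]_t (g t (u t) : R))%R].
Proof.
have [g gF] := dualX_RNP (@dual_measure_vector_measure _ _ _ mu _ _ p1 F)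
  (@dual_measure_small _ _ _ mu _ _ p1 F) (@dual_measure_variation _ _ _ mu _ _ p1 F).
have sg := Lp_fun_sm g; have Ng := Lp_Lnorm_lty g.
(* On indicators the formula is the Radon-Nikodym property evaluated at a vector; additivity extends
   it to simple functions. *)
have Fsimple s : simple_function s ->
    forall S : Lp, {ae mu, forall t, S t = s t} -> F S = (\int[mu]_t (g t (s t) : R))%R.
  elim/simple_function_ind : s / => [E x mE S Ss|].
    have -> : S = Lp_indic mu p1 E x.
      apply/Lp_eqP; have := Ss; apply: filter_app.
      by apply: filterS (Lp_indicE mu p1 x mE) => t -> ->.
    rewrite -dual_measureE//.
    rewrite (has_bochner_integral_pairing x mE sg Ng (gF E mE)).
    by apply: eq_Rintegral => t _; rewrite linearZ.
  move=> f h sf sh IHf IHh S Ss.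
  have [U Uf] := Lp_simple mu p1 sf; have [V Vh] := Lp_simple mu p1 sh.
  have -> : S = U + V.
    apply/Lp_eqP; have := Ss; apply: filter_app.
    have := Uf; apply: filter_app; have := Vh; apply: filter_app.
    by apply: filterS (Lp_funD U V) => t -> -> -> ->.
  have -> : F (U + V) = F U + F V by exact: linearD.
  rewrite (IHf U)// (IHh V)// -RintegralD//.
  - by apply: eq_Rintegral => t _; rewrite linearD.
  - exact: pairing_integrable_simple.
  - exact: pairing_integrable_simple.
have Nq := ge_norm_pairing q1 pq sg Ng (fun s S ss => Fsimple s ss S).
exists g; split => // u.
(* Since [g] is in [L_q], pairing with it is continuous on all of [L_p], and density of simple
   functions identifies it with [F]. *)
have [G Gg] := dual_of_pairing p1 (ltW q1) pq sg (le_lt_trans Nq (ltry _)).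
suff -> : F = G by [].
apply: dual_Lp_eq => s S ss Ss; rewrite (Fsimple s ss S Ss) Gg.
apply: Rintegral_ae_eq.
- by apply: measurable_pairing => //; exact: simple_strongly_measurable.
- by apply: measurable_pairing => //; exact: Lp_fun_sm.
- by apply: filterS Ss => t ->.
Qed.

End RNPRepresentation.

(** * Transfer between [Y] and [L_p(mu, Y)] *)

Section Transfer.
Context d {T : measurableType d} {R : realType} (mu : probability T R).
Context {X : normedModType R} (Y : submodClosed X) (p q : R) (p1 : 1 <= p).
Hypotheses (q1 : 1 < q) (pq : p^-1 + q^-1 = 1).
Local Notation Lp := (Lp mu X p1).
Local Notation LpY := (Lp_subspace mu p1 Y).

Let p0 : 0 < p. Proof. exact: lt_le_trans p1. Qed.
Let q0 : 0 < q. Proof. exact: lt_trans q1. Qed.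

(** A relation and not a map: [g] is determined by [F] only up to null sets, and a constant function
    can serve as density as it stands. *)
Definition represents (F : dual Lp) (g : T -> dual X) : Prop :=
  [/\ strongly_measurable g, ('N[mu]_q%:E[(fun t => `|g t|%:E)] < +oo)%E &
  forall u : Lp, F u = (\int[mu]_t (g t (u t) : R))%R].

Lemma represents_lin a (F G : dual Lp) (g h : T -> dual X) :
  represents F g -> represents G h ->
  represents (a *: F + G) (fun t => a *: g t + h t).
Proof.
move=> [sg Ng Fg] [sh Nh Gh].
have /asboolP[sgh Ngh] := (Lpfun_submod_closed mu (dual X) (ltW q1)).2 a g h
  (introT (asboolP _) (conj sg Ng)) (introT (asboolP _) (conj sh Nh)).
split => // u.
have -> : (a *: F + G) u = a * F u + G u by [].
have ig := pairing_integrable (ltW q1) pq u sg Ng.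
have ih := pairing_integrable (ltW q1) pq u sh Nh.
rewrite Fg Gh -RintegralZl// -RintegralD//.
exact: (integrableZl measurableT a ig).
Qed.

(** The difference of the [q]-th powers is nonnegative and, the norms being finite, has integral 0;
    so it vanishes almost everywhere. *)
Lemma Lnorm_ae_eq_norm (a b : T -> R) : measurable_fun setT a ->
  measurable_fun setT b -> (forall t, 0 <= a t <= b t) ->
  ('N[mu]_q%:E[EFin \o b] < +oo)%E ->
  ('N[mu]_q%:E[EFin \o b] <= 'N[mu]_q%:E[EFin \o a])%E ->
  {ae mu, forall t, a t = b t}.
Proof.
move=> ma mb ab Nb ba.
have Na : ('N[mu]_q%:E[EFin \o a] < +oo)%E.
  apply: le_lt_trans Nb; apply: le_Lnorm_ae => //; first exact: ltW.
  by apply: aeW => t; have /andP[a0 abt] := ab t; rewrite ger0_norm.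
have iA := Lnorm_lty_integrable q0 ma Na.
have iB := Lnorm_lty_integrable q0 mb Nb.
have iBA := integrableB measurableT iB iA.
have AB t : `|a t| `^ q <= `|b t| `^ q.
  have /andP[a0 abt] := ab t.
  by rewrite ge0_ler_powR ?nnegrE ?(ltW q0)// !ger0_norm ?(le_trans a0).
have le_int : (\int[mu]_t (`|b t| `^ q))%R <= (\int[mu]_t (`|a t| `^ q))%R.
  rewrite -lee_fin !fineK ?integrable_fin_num//.
  have qn0 : q != 0 by rewrite gt_eqF.
  rewrite -[leLHS](@poweR_Lnorm _ _ _ mu (EFin \o b) q qn0).
  rewrite -[leRHS](@poweR_Lnorm _ _ _ mu (EFin \o a) q qn0).
  by apply: gt0_ler_poweR => //; rewrite ?(ltW q0)// in_itv/= leey andbT Lnorm_ge0.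
have int0 : (\int[mu]_t `|(`|b t| `^ q - `|a t| `^ q)%:E| = 0)%E.
  under eq_integral do rewrite gee0_abs ?lee_fin ?subr_ge0//.
  rewrite -[LHS]fineK ?integrable_fin_num//; congr EFin.
  rewrite -[LHS]/((\int[mu]_t (`|b t| `^ q - `|a t| `^ q))%R) RintegralB//.
  apply/eqP; rewrite eq_le subr_le0 le_int subr_ge0.
  by apply: le_Rintegral.
have mBA : measurable_fun setT (fun t => (`|b t| `^ q - `|a t| `^ q)%:E).
  exact: measurable_int iBA.
move/(ae_eq_integral_abs mu measurableT mBA) : int0; apply: filterS => t /(_ I) /= [].
move/eqP; rewrite subr_eq0 => /eqP/esym.
have /andP[a0 abt] := ab t; have b0 := le_trans a0 abt.
by rewrite !ger0_norm//; apply: (powR_injective q0); rewrite nnegrE.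
Qed.

(** The [L_q] norm of [g] is at most [|F|], hence at most the norm of the restriction of [F], hence
    at most the [L_q] norm of the restricted [g t]. The pointwise norms being ordered the other way,
    they agree almost everywhere. *)
Lemma norm_preserving_represents (F : dual Lp) g : represents F g ->
  norm_preserving LpY F -> {ae mu, forall t, norm_preserving Y (g t)}.
Proof.
move=> [sg Ng Fg] nF.
suff : {ae mu, forall t, `|dual_restr Y (g t)| = `|g t|}.
  by apply: filterS => t; rewrite /norm_preserving => ->.
have mr := measurable_norm_restr sg Y.
have Nr := Lnorm_restr_le mu (ltW q1) sg Y.
apply: Lnorm_ae_eq_norm => //.
- exact: strongly_measurable_norm.
- by move=> t; rewrite normr_ge0 le_dual_restr.
apply: (@le_trans _ _ `|dual_restr LpY F|%:E).
  apply: le_trans (_ : (`|F|%:E <= _)%E); last by rewrite lee_fin.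
  apply: (ge_norm_pairing q1 pq sg).
    by apply: (Lnorm1_lty q1) => //; exact: strongly_measurable_norm.
  move=> s S ss Ss; rewrite Fg; apply: Rintegral_ae_eq.
  - by apply: measurable_pairing => //; exact: Lp_fun_sm.
  - by apply: measurable_pairing => //; exact: simple_strongly_measurable.
  - by apply: filterS Ss => t ->.
rewrite -[leRHS]fineK; last by rewrite ge0_fin_numE ?Lnorm_ge0// (le_lt_trans Nr).
rewrite lee_fin; exact: (le_norm_restr_pairing (ltW q1) pq sg Ng Fg).
Qed.

(** The mirror chain: the upper bound is used for [F] and the lower bound for its restriction. *)
Lemma represents_norm_preserving (F : dual Lp) g : represents F g ->
  {ae mu, forall t, norm_preserving Y (g t)} -> norm_preserving LpY F.
Proof.
move=> [sg Ng Fg] ng; rewrite /norm_preserving -lee_fin.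
apply: le_trans (ge_norm_restr_pairing q1 pq Y sg Ng Fg).
apply: (@le_trans _ _ ('N[mu]_q%:E[(fun t => `|g t|%:E)])%E).
  rewrite -[leRHS]fineK ?ge0_fin_numE ?Lnorm_ge0// lee_fin.
  exact: (le_norm_pairing (ltW q1) pq sg Ng Fg).
apply: (@le_Lnorm_ae _ _ _ mu (fun t => `|g t|)) => //; first exact: ltW.
- exact: strongly_measurable_norm.
- exact: measurable_norm_restr.
by apply: filterS ng => t; rewrite normr_id.
Qed.

(** The lower bound is applied to [F - G], represented by [k]: its restriction is 0, so the norm of
    [k t] on [Y] has [L_q] norm 0. *)
Lemma represents_restr_eq (F G : dual Lp) g h :
  represents F g -> represents G h -> dual_restr LpY F = dual_restr LpY G ->
  {ae mu, forall t, dual_restr Y (g t) = dual_restr Y (h t)}.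
Proof.
move=> Fg Gh FG.
pose k t := -1 *: h t + g t.
have [sk Nk Fk] : represents (-1 *: G + F) k := represents_lin (-1) Gh Fg.
have := ge_norm_restr_pairing q1 pq Y sk Nk Fk.
rewrite scaleN1r addrC dual_restrB FG subrr normr0 => N0.
have mk := measurable_norm_restr sk Y.
have : {ae mu, forall t, `|dual_restr Y (k t)| = 0}.
  have {N0} N0 : ('N[mu]_q%:E[EFin \o (fun t => `|dual_restr Y (k t)|%R)] = 0)%E.
    by apply/eqP; rewrite eq_le N0 Lnorm_ge0.
  have := Lnorm_eq0_eq0 (iffRL (measurable_EFinP _ _) mk) _ N0.
  by rewrite lte_fin => /(_ q0); apply: filterS => t /(_ I) [].
apply: filterS => t /normr0_eq0; rewrite /k; rewrite scaleN1r addrC dual_restrB => /eqP.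
by rewrite subr_eq0 => /eqP.
Qed.

Lemma represents_ae_eq (F G : dual Lp) g h : represents F g -> represents G h ->
  {ae mu, forall t, g t = h t} -> F = G.
Proof.
move=> [sg _ Fg] [sh _ Gh] gh; apply: dual_ext => u; rewrite Fg Gh.
apply: Rintegral_ae_eq.
- by apply: measurable_pairing => //; exact: Lp_fun_sm.
- by apply: measurable_pairing => //; exact: Lp_fun_sm.
- by apply: filterS gh => t ->.
Qed.

Lemma represents_cst (f : dual X) : exists F, represents F (cst f).
Proof.
have sf : simple_function (cst f : T -> dual X) by exact: simple_cst.
have Nf := simple_Lnorm_lty mu (ltW q1) sf.
have [F Ff] := dual_of_pairing p1 (ltW q1) pq (simple_strongly_measurable sf) Nf.
by exists F; split => //; exact: simple_strongly_measurable.
Qed.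

Lemma represents_cst_norm_preserving (F : dual Lp) f : represents F (cst f) ->
  norm_preserving LpY F <-> norm_preserving Y f.
Proof.
move=> Ff; split=> nf; last by apply: (represents_norm_preserving Ff); exact: aeW.
have h := norm_preserving_represents Ff nf.
(* As [mu] has positive mass, an almost sure statement that does not depend on [t] is true. *)
have muT : (0 < mu setT)%E by rewrite probability_setT.
by have [] := @filter_ex _ _ (ae_properfilter_algebraOfSetsType muT) _ h.
Qed.

Lemma represents_cst_eval (F : dual Lp) f x (U : Lp) : represents F (cst f) ->
  {ae mu, forall t, U t = x} -> F U = f x.
Proof.
move=> [sf _ Ff] Ux; rewrite Ff.
rewrite (@Rintegral_ae_eq _ _ _ mu _ (cst (f x)))//.
- rewrite Rintegral_cst// [fine _](_ : _ = 1) ?mulr1//.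
  exact: (congr1 fine (probability_setT mu)).
- by apply: measurable_pairing => //; exact: Lp_fun_sm.
- by apply: filterS Ux => t ->.
Qed.

Lemma represents_cst_inj (F : dual Lp) f h :
  represents F (cst f) -> represents F (cst h) -> f = h.
Proof.
move=> Ff Fh; apply: dual_ext => x.
have [U Ux] := Lp_simple mu p1 (@simple_cst _ T _ _ x).
by rewrite -(represents_cst_eval Ff Ux) -(represents_cst_eval Fh Ux).
Qed.

Lemma represents_cst_restr_eq (F G : dual Lp) f h :
  represents F (cst f) -> represents G (cst h) ->
  dual_restr Y f = dual_restr Y h -> dual_restr LpY F = dual_restr LpY G.
Proof.
move=> [sf _ Ff] [sh _ Gh] /dual_restr_eq fh; apply/dual_restr_eq => u /asboolP uY.
rewrite Ff Gh; apply: Rintegral_ae_eq.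
- by apply: measurable_pairing => //; exact: Lp_fun_sm.
- by apply: measurable_pairing => //; exact: Lp_fun_sm.
- by apply: filterS uY => t; exact: fh.
Qed.

Lemma property_U_of_Lp : property_U LpY -> property_U Y.
Proof.
move=> /property_UP U; apply/property_UP => f h nf nh fh.
have [F Ff] := represents_cst f; have [G Gh] := represents_cst h.
suff FG : F = G by apply: (represents_cst_inj Ff); rewrite FG.
apply: U; last exact: represents_cst_restr_eq Ff Gh fh.
  exact/(represents_cst_norm_preserving Ff).
exact/(represents_cst_norm_preserving Gh).
Qed.

Lemma property_SU_of_Lp : property_SU LpY -> property_SU Y.
Proof.
move=> /property_SUP[U nD]; apply/property_SUP; split; first exact: property_U_of_Lp.
move=> f h nf nh.
have [F Ff] := represents_cst f; have [G Gh] := represents_cst h.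
have FGfh : represents (F + G) (cst (f + h)).
  rewrite -[F]scale1r (_ : cst _ = fun t => 1 *: cst f t + cst h t).
    exact: represents_lin.
  by apply/funext => t; rewrite scale1r.
apply/(represents_cst_norm_preserving FGfh); apply: nD.
  exact/(represents_cst_norm_preserving Ff).
exact/(represents_cst_norm_preserving Gh).
Qed.

Hypothesis dualX_RNP : radon_nikodym_property (dual X).

Lemma represents_exists (F : dual Lp) : exists g, represents F g.
Proof.
have [g [sg Ng Fg]] := dual_Lp_representation q1 pq dualX_RNP F.
by exists g; split => //; exact: le_lt_trans Ng (ltry _).
Qed.

Lemma property_U_Lp : property_U Y -> property_U LpY.
Proof.
move=> /property_UP U; apply/property_UP => F G nF nG FG.
have [g Fg] := represents_exists F; have [h Gh] := represents_exists G.
apply: (represents_ae_eq Fg Gh).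
apply: filterS3 (norm_preserving_represents Fg nF)
  (norm_preserving_represents Gh nG) (represents_restr_eq Fg Gh FG) => t.
exact: U.
Qed.

Lemma property_SU_Lp : property_SU Y -> property_SU LpY.
Proof.
move=> /property_SUP[U nD]; apply/property_SUP; split; first exact: property_U_Lp.
move=> F G nF nG.
have [g Fg] := represents_exists F; have [h Gh] := represents_exists G.
rewrite -[F]scale1r; apply: (represents_norm_preserving (represents_lin 1 Fg Gh)).
apply: filterS2 (norm_preserving_represents Fg nF)
  (norm_preserving_represents Gh nG) => t gt ht.
by rewrite scale1r; exact: nD.
Qed.

End Transfer.

Theorem theorem3p4 (R : realType) (d : measure_display)
    (Omega : measurableType d) (mu : probability Omega R)
    (X : completeNormedModType R) (Y : submodClosed X)
    (Y_closed : closed [set` Y])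
    (dualX_RNP : radon_nikodym_property (dual X)) :
  (forall (p : R) (p_gt1 : 1 < p),
     property_U Y <-> property_U (Lp_subspace mu (ltW p_gt1) Y)) /\
  (forall (p : R) (p_gt1 : 1 < p),
     property_SU Y <-> property_SU (Lp_subspace mu (ltW p_gt1) Y)).
Proof.
(* The conjugate exponent [p / (p - 1)], which makes sense because [p > 1]. *)
have conjugate (p : R) : 1 < p -> 1 < (1 - p^-1)^-1 /\ p^-1 + (1 - p^-1)^-1^-1 = 1.
  move=> p1; have p0 : 0 < p by exact: lt_trans p1.
  split; last by rewrite invrK addrC subrK.
  by rewrite invf_gt1 ?subr_gt0 ?invf_lt1// ltrBlDr ltrDl invr_gt0.
split=> p p1; have [q1 pq] := conjugate p p1; split.
- exact: (property_U_Lp q1 pq dualX_RNP).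
- exact: (property_U_of_Lp q1 pq).
- exact: (@property_SU_Lp _ _ _ mu X Y _ _ (ltW p1) q1 pq dualX_RNP).
- exact: (property_SU_of_Lp q1 pq).
Qed.
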